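(* Let $\mathcal{C}(\mathcal{Z})$ be the discrete cluster category associated to an admissible subset $\mathcal{Z}\subseteq S^1$ with $n\ge 2$ limit points. The lattice of equivalence classes of non-degenerate t-structures of $\mathcal{C}(\mathcal{Z})$ is isomorphic to the lattice of non-crossing partitions of $[n]$. Its top is given by the equivalence class of non-degenerate bounded above t-structures, and its bottom by the equivalence class of non-degenerate bounded below t-structures.
   Context: **Combinatorial setting.** $\mathbb{K}$ is a field. $S^1$ is the unit circle with anti-clockwise cyclic order: for pairwise distinct $x,y,z\in S^1$, $x<y<z$ means that going anti-clockwise one meets first $x$, then $y$, then $z$; for $m\ge 3$, $x_1<\dots<x_m$ means $x_i<x_{i+1}<x_{i+2}$ for all $i$ (indices modulo $m$). $\mathcal{Z}\subseteq S^1$ is admissible: discrete, infinite, with set of limit points $L(\mathcal{Z})=\overline{\mathcal{Z}}\setminus\mathcal{Z}$ ($\overline{\mathcal{Z}}$ the topological closure) finite of cardinality $n$ (here $n\geq 2$), every limit point being a two-sided limit point. Each $z\in\mathcal{Z}$ has an immediate successor $z^+$ and predecessor $z^-$ in $\mathcal{Z}$ (anti-clockwise, resp. clockwise neighbour). An arc of $\mathcal{Z}$ is a 2-element subset $\{z_0,z_1\}\subseteq\mathcal{Z}$ with $z_1\notin\{z_0^-,z_0,z_0^+\}$. Arcs $\{y_0,y_1\},\{y_0',y_1'\}$ cross if $y_0<y_0'<y_1<y_1'$ or $y_0<y_1'<y_1<y_0'$. **The category.** $\mathcal{C}(\mathcal{Z})$ is the discrete cluster category of Igusa–Todorov: a $\mathbb{K}$-linear,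 2-Calabi–Yau, Krull–Schmidt triangulated category with suspension $\Sigma$ whose non-zero indecomposable objects correspond to arcs of $\mathcal{Z}$ (same notation for arc and object), with: - $\Sigma\{y_0,y_1\}=\{y_0^-,y_1^-\}$; - $\mathrm{Hom}(\{y_0,y_1\},\Sigma\{y_0',y_1'\})=\mathbb{K}$ if the arcs $\{y_0,y_1\}$ and $\{y'_0,y'_1\}$ cross, and $0$ otherwise; - a non-zero morphism $\{y_0,y_1\}\to\{y_0',y_1'\}$ with $y_0<y_0'^+<y_1<y_1'^+$ factors through an indecomposable $S$ iff $S=\{s_0,s_1\}$ with $y_0\le s_0\le y_0'$ and $y_1\le s_1\le y_1'$; - if $y_0<y_0'<y_1<y_1'$, every non-zero $f:\{y_0,y_1\}\to\Sigma\{y_0',y_1'\}$ sits in a triangle $\{y_0',y_1'\}\to X\oplus Z\to\{y_0,y_1\}\xrightarrow{f}\Sigma\{y_0',y_1'\}$ with $X=\{y_0,y_0'\}$, $Z=\{y_1,y_1'\}$ (read as $0$ when not an arc); the components of the first two maps to and from $X$, $Z$ are non-zero when the corresponding objects are non-zero. All subcategories are full and closed under direct sums and summands. **t-structures.** A torsion pair in a triangulated category $\mathcal{T}$ is a pair $(\mathcal{X},\mathcal{Y})$ of subcategories closed under direct summands with $\mathrm{Hom}(X,Y)=0$ for $X\in\mathcal{X},Y\in\mathcal{Y}$ and such that every $T\in\mathcal{T}$ has a distinguished triangle $X\to T\to Y\to\Sigma X$ with $X\in\mathcal{X},Y\in\mathcal{Y}$. A t-structure is a torsion pair with $\Sigma\mathcal{X}\subseteq\mathcal{X}$;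 $\mathcal{X}$ is its aisle, $\mathcal{Y}$ its coaisle. A t-structure in $\mathcal{T}=\mathcal{C}(\mathcal{Z})$ is non-degenerate if $\bigcap_{k\in\mathbb{Z}}\Sigma^k\mathcal{X}=0$ and $\bigcap_{k\in\mathbb{Z}}\Sigma^k\mathcal{Y}=0$; bounded above if $\bigcup_{k\in\mathbb{Z}}\Sigma^k\mathcal{X}=\mathcal{C}(\mathcal{Z})$; bounded below if $\bigcup_{k\in\mathbb{Z}}\Sigma^k\mathcal{Y}=\mathcal{C}(\mathcal{Z})$. **Equivalence and order.** Two t-structures $(\mathcal{X},\mathcal{Y})$, $(\mathcal{X}',\mathcal{Y}')$ are equivalent if there is an integer $N>0$ with $\Sigma^N\mathcal{X}\subseteq\mathcal{X}'\subseteq\Sigma^{-N}\mathcal{X}$. Equivalence classes are ordered by: $[(\mathcal{X},\mathcal{Y})]\le[(\mathcal{X}',\mathcal{Y}')]$ if for every $(\tilde{\mathcal{X}},\tilde{\mathcal{Y}})\in[(\mathcal{X},\mathcal{Y})]$ there is $(\tilde{\mathcal{X}}',\tilde{\mathcal{Y}}')\in[(\mathcal{X}',\mathcal{Y}')]$ with $\tilde{\mathcal{X}}\subseteq\tilde{\mathcal{X}}'$. **Non-crossing partitions.** A non-crossing partition of $[n]=\{1,\dots,n\}$ is a partition of $[n]$ such that whenever $i<k<j<l$ with $i,j$ in a block $B$ and $k,l$ in a block $B'$, then $B=B'$. They form a lattice under refinement: $\mathcal{P}\le\mathcal{P}'$ iff every block of $\mathcal{P}$ is contained in a block of $\mathcal{P}'$.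 *)

(* Defs.v *)
From HB Require Import structures.
From mathcomp Require Import all_boot all_order all_algebra.
From mathcomp Require Import all_classical all_reals all_analysis.
Set Implicit Arguments.
Unset Strict Implicit.
Unset Printing Implicit Defensive.
Import Order.TTheory GRing.Theory Num.Theory.
Import numFieldNormedType.Exports.
Local Open Scope classical_set_scope.
Local Open Scope ring_scope.

Record klinear_category (K : fieldType) := KLinearCategory {
  obj :> Type;
  Hom : obj -> obj -> lmodType K;
  idm : forall X, Hom X X;
  mcomp : forall X Y Z, Hom Y Z -> Hom X Y -> Hom X Z;
  mcomp1m : forall X Y (f : Hom X Y), mcomp (idm Y) f = f;
  mcompm1 : forall X Y (f : Hom X Y), mcomp f (idm X) = f;
  mcompA : forall X Y Z W (h : Hom Z W) (g : Hom Y Z) (f : Hom X Y),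
    mcomp h (mcomp g f) = mcomp (mcomp h g) f;
  mcomp_linearl : forall X Y Z (f : Hom X Y),
    linear (fun g : Hom Y Z => mcomp g f);
  mcomp_linearr : forall X Y Z (g : Hom Y Z),
    linear (fun f : Hom X Y => mcomp g f) }.

Arguments Hom {K C} X Y : rename.
Arguments idm {K C} X : rename.
Arguments mcomp {K C X Y Z} g f : rename.

Notation "g \oC f" := (mcomp g f) (at level 40, left associativity).

Section LinearCategory.
Variables (K : fieldType) (C : klinear_category K).
Implicit Types X Y S : C.

Definition is_iso X Y (f : Hom X Y) : Prop :=
  exists g : Hom Y X, g \oC f = idm X /\ f \oC g = idm Y.

Definition isomorphic X Y : Prop := exists f : Hom X Y, is_iso f.

Definition is_zero X : Prop := idm X = 0.

Definition is_biproduct X Y S (i1 : Hom X S) (i2 : Hom Y S)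
    (p1 : Hom S X) (p2 : Hom S Y) : Prop :=
  [/\ p1 \oC i1 = idm X, p2 \oC i2 = idm Y, p1 \oC i2 = 0, p2 \oC i1 = 0
    & i1 \oC p1 + i2 \oC p2 = idm S].

Definition is_direct_sum X Y S : Prop :=
  exists i1 i2 p1 p2, @is_biproduct X Y S i1 i2 p1 p2.

Fixpoint is_finite_direct_sum (s : seq C) S : Prop :=
  if s is X :: s' then
    exists S', is_finite_direct_sum s' S' /\ is_direct_sum X S' S
  else is_zero S.

Definition additive_category : Prop :=
  (exists X : C, is_zero X) /\ (forall X Y, exists S, is_direct_sum X Y S).

Definition indecomposable X : Prop :=
  ~ is_zero X /\
  forall Y Y', is_direct_sum Y Y' X -> is_zero Y \/ is_zero Y'.

Definition local_endomorphism_ring X : Prop :=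
  ~ is_zero X /\ forall e : Hom X X, is_iso e \/ is_iso (idm X - e).

Definition krull_schmidt : Prop :=
  forall X, exists s : seq C, is_finite_direct_sum s X /\
    forall i, (i < size s)%N -> local_endomorphism_ring (nth X s i).

Definition factors_through X Y (f : Hom X Y) S : Prop :=
  exists (g : Hom X S) (h : Hom S Y), f = h \oC g.

(* Membership in a subcategory; with the zero objects in, closure under sums  *)
(* and summands gives closure under isomorphism.                              *)
Definition is_subcategory (P : set C) : Prop :=
  [/\ forall X, is_zero X -> P X,
      forall X Y S, is_direct_sum X Y S -> P X -> P Y -> P S
    & forall X Y S, is_direct_sum X Y S -> P S -> P X /\ P Y].

Definition zero_subcategory : set C := [set X | is_zero X].

End LinearCategory.

Record triangulated_category (K : fieldType) := TriangulatedCategory {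
  tcat :> klinear_category K;
  tcat_additive : additive_category tcat;
  (* the suspension, a K-linear autoequivalence *)
  susp : tcat -> tcat;
  suspm : forall X Y : tcat, Hom X Y -> Hom (susp X) (susp Y);
  suspm1 : forall X, suspm (idm X) = idm (susp X);
  suspmM : forall (X Y Z : tcat) (g : Hom Y Z) (f : Hom X Y),
    suspm (g \oC f) = suspm g \oC suspm f;
  suspm_linear : forall X Y, linear (@suspm X Y);
  suspm_bij : forall X Y, bijective (@suspm X Y);
  susp_surj : forall Y, exists X, isomorphic (susp X) Y;
  (* X --f--> Y --g--> Z --h--> susp X is a distinguished triangle *)
  dist : forall X Y Z : tcat, Hom X Y -> Hom Y Z -> Hom Z (susp X) -> Prop;
  dist_id : forall X Z : tcat, is_zero Z ->
    dist (idm X) (0 : Hom X Z) (0 : Hom Z (susp X));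
  dist_iso : forall (X Y Z X' Y' Z' : tcat)
      (f : Hom X Y) (g : Hom Y Z) (h : Hom Z (susp X))
      (f' : Hom X' Y') (g' : Hom Y' Z') (h' : Hom Z' (susp X'))
      (a : Hom X X') (b : Hom Y Y') (c : Hom Z Z'),
    is_iso a -> is_iso b -> is_iso c ->
    b \oC f = f' \oC a -> c \oC g = g' \oC b -> suspm a \oC h = h' \oC c ->
    dist f g h -> dist f' g' h';
  dist_complete : forall (X Y : tcat) (f : Hom X Y),
    exists (Z : tcat) (g : Hom Y Z) (h : Hom Z (susp X)), dist f g h;
  dist_rotate : forall (X Y Z : tcat)
      (f : Hom X Y) (g : Hom Y Z) (h : Hom Z (susp X)),
    dist f g h <-> dist g h (- suspm f);
  dist_morphism : forall (X Y Z X' Y' Z' : tcat)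
      (f : Hom X Y) (g : Hom Y Z) (h : Hom Z (susp X))
      (f' : Hom X' Y') (g' : Hom Y' Z') (h' : Hom Z' (susp X'))
      (a : Hom X X') (b : Hom Y Y'),
    dist f g h -> dist f' g' h' -> b \oC f = f' \oC a ->
    exists c : Hom Z Z', c \oC g = g' \oC b /\ suspm a \oC h = h' \oC c;
  dist_octahedron : forall (X Y Z X' Y' Z' : tcat) (f : Hom X Y) (g : Hom Y Z)
      (u : Hom Y Z') (u' : Hom Z' (susp X))
      (v : Hom Z X') (v' : Hom X' (susp Y))
      (w : Hom Z Y') (w' : Hom Y' (susp X)),
    dist f u u' -> dist g v v' -> dist (g \oC f) w w' ->
    exists (a : Hom Z' Y') (b : Hom Y' X'),
      [/\ dist a b (suspm u \oC v'),
          a \oC u = w \oC g /\ w' \oC a = u'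
        & b \oC w = v /\ v' \oC b = suspm f \oC w'] }.

Arguments susp {K T} X : rename.
Arguments suspm {K T X Y} f : rename.
Arguments dist {K T X Y Z} f g h : rename.

Section Triangulated.
Variables (K : fieldType) (T : triangulated_category K).

(* The natural isomorphism Hom(X, Y) ~ Hom(Y, susp^2 X)^* is given by the     *)
(* pairing q: the map f |-> q f is linear with values in linear functionals,  *)
(* bijective onto them, and natural in Y and in X.                            *)
Definition calabi_yau2 : Prop :=
  exists q : forall X Y : T, Hom X Y -> Hom Y (susp (susp X)) -> K,
  [/\ forall X Y (f : Hom X Y), linear (q X Y f : _ -> K^o),
      forall X Y (g : Hom Y (susp (susp X))), linear (q X Y ^~ g : _ -> K^o),
      forall X Y (phi : Hom Y (susp (susp X)) -> K), linear (phi : _ -> K^o) ->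
        exists! f : Hom X Y, forall g, q X Y f g = phi g,
      forall X Y Y' (f : Hom X Y) (b : Hom Y Y') (g : Hom Y' (susp (susp X))),
        q X Y' (b \oC f) g = q X Y f (g \oC b)
    & forall X X' Y (a : Hom X' X) (f : Hom X Y) (g : Hom Y (susp (susp X'))),
        q X' Y (f \oC a) g = q X Y f (suspm (suspm a) \oC g)].

(* susp^k P. For k < 0 the essential image of P under susp^k is the preimage  *)
(* of P under susp^(- k), as P is closed under isomorphism.                   *)
Definition susp_sub (k : int) (P : set T) : set T :=
  match k with
  | Posz m => [set X | exists2 Y, P Y & isomorphic X (iter m susp Y)]
  | Negz m => [set X | P (iter m.+1 susp X)]
  end.

Definition is_torsion_pair (t : set T * set T) : Prop :=
  [/\ is_subcategory t.1, is_subcategory t.2,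
      forall X Y, t.1 X -> t.2 Y -> forall f : Hom X Y, f = 0
    & forall Z, exists X Y (f : Hom X Z) (g : Hom Z Y) (h : Hom Y (susp X)),
        [/\ t.1 X, t.2 Y & dist f g h]].

(* t.1 is the aisle and t.2 the coaisle. *)
Definition is_tstructure (t : set T * set T) : Prop :=
  is_torsion_pair t /\ susp_sub 1 t.1 `<=` t.1.

Definition nondegenerate_tpair (t : set T * set T) : Prop :=
  \bigcap_(k in [set: int]) susp_sub k t.1 = zero_subcategory (C := T) /\
  \bigcap_(k in [set: int]) susp_sub k t.2 = zero_subcategory (C := T).

Definition bounded_above (t : set T * set T) : Prop :=
  \bigcup_(k in [set: int]) susp_sub k t.1 = [set: T].

Definition bounded_below (t : set T * set T) : Prop :=
  \bigcup_(k in [set: int]) susp_sub k t.2 = [set: T].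

Definition tequiv (t t' : set T * set T) : Prop :=
  exists2 N : nat, (0 < N)%N &
    susp_sub N%:Z t.1 `<=` t'.1 /\ t'.1 `<=` susp_sub (- N%:Z) t.1.

Definition tclass (t : set T * set T) : set (set T * set T) :=
  [set t' | is_tstructure t' /\ tequiv t t'].

Definition tclass_le (c c' : set (set T * set T)) : Prop :=
  forall t, c t -> exists2 t', c' t' & t.1 `<=` t'.1.

Definition nondegenerate_classes : set (set (set T * set T)) :=
  [set c | exists t, [/\ is_tstructure t, nondegenerate_tpair t & c = tclass t]].

End Triangulated.

Arguments tclass_le {K T} c c'.
Arguments nondegenerate_classes {K} T.

Section Circle.
Variable R : realType.
Implicit Types (x y z : R * R) (Z A B : set (R * R)).

Definition circle : set (R * R) := [set x | x.1 ^+ 2 + x.2 ^+ 2 = 1].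

Definition circle_point (theta : R) : R * R := (cos theta, sin theta).

(* x < y < z in the anti-clockwise cyclic order *)
Definition cyc3 x y z : Prop :=
  exists a b c : R, (a < b < c) && (c < a + 2 * pi) /\
    [/\ x = circle_point a, y = circle_point b & z = circle_point c].

Definition cyc4 x1 x2 x3 x4 : Prop :=
  [/\ cyc3 x1 x2 x3, cyc3 x2 x3 x4, cyc3 x3 x4 x1 & cyc3 x4 x1 x2].

(* x <= y <= z, for y in the anti-clockwise closed arc of circle from x to z  *)
Definition cyc3_le x y z : Prop := [\/ y = x, y = z | cyc3 x y z].

Definition limit_points Z : set (R * R) := closure Z `\` Z.

Definition two_sided_limit Z x : Prop :=
  exists2 theta, x = circle_point theta & forall e : R, 0 < e ->
    (exists2 d, 0 < d < e & Z (circle_point (theta + d))) /\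
    (exists2 d, 0 < d < e & Z (circle_point (theta - d))).

Definition admissible (n : nat) Z : Prop :=
  [/\ Z `<=` circle /\ infinite_set Z,
      forall z, Z z -> isolated Z z,
      (limit_points Z #= `I_n)%card
    & forall x, limit_points Z x -> two_sided_limit Z x].

Definition is_successor Z z w : Prop :=
  [/\ Z z, Z w, z <> w & forall u, Z u -> ~ cyc3 z u w].

(* z^+ and z^- *)
Definition zsucc Z z : R * R := xget z [set w | is_successor Z z w].
Definition zpred Z z : R * R := xget z [set w | is_successor Z w z].

Definition arc_pair Z z0 z1 : Prop :=
  [/\ Z z0, Z z1 & ~ [set zpred Z z0; z0; zsucc Z z0] z1].

Definition is_arc Z A : Prop :=
  exists z0 z1, A = [set z0; z1] /\ arc_pair Z z0 z1.

Definition crossing A B : Prop :=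
  exists y0 y1 y0' y1', [/\ A = [set y0; y1], B = [set y0'; y1']
    & cyc4 y0 y0' y1 y1' \/ cyc4 y0 y1' y1 y0'].

End Circle.

Section DiscreteCluster.
Variables (K : fieldType) (T : triangulated_category K) (R : realType).
Variables (Z : set (R * R)) (E : set (R * R) -> T).

(* X is the object {z0, z1}, read as 0 when this is not an arc *)
Definition arc_or_zero (A : set (R * R)) (X : T) : Prop :=
  (is_arc Z A -> X = E A) /\ (~ is_arc Z A -> is_zero X).

(* E A is the indecomposable object of the arc A; the values of E outside     *)
(* arcs are irrelevant. C(Z) is not constructed: it enters only through the   *)
(* structure below.                                                           *)
Record discrete_cluster_category : Prop := DiscreteClusterCategory {
  dcc_krull_schmidt : krull_schmidt T;
  dcc_calabi_yau : calabi_yau2 T;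
  dcc_indecomposable : forall A, is_arc Z A -> indecomposable (E A);
  dcc_indecomposableP : forall X : T, indecomposable X ->
    exists2 A, is_arc Z A & isomorphic X (E A);
  dcc_inj : forall A B, is_arc Z A -> is_arc Z B ->
    isomorphic (E A) (E B) -> A = B;
  dcc_susp : forall y0 y1, is_arc Z [set y0; y1] ->
    isomorphic (susp (E [set y0; y1])) (E [set zpred Z y0; zpred Z y1]);
  dcc_hom_crossing : forall A B, is_arc Z A -> is_arc Z B -> crossing A B ->
    exists phi : {linear K^o -> Hom (E A) (susp (E B))}, bijective phi;
  dcc_hom_noncrossing : forall A B, is_arc Z A -> is_arc Z B ->
    ~ crossing A B -> forall f : Hom (E A) (susp (E B)), f = 0;
  dcc_factor : forall y0 y1 y0' y1',
    is_arc Z [set y0; y1] -> is_arc Z [set y0'; y1'] ->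
    cyc4 y0 (zsucc Z y0') y1 (zsucc Z y1') ->
    forall f : Hom (E [set y0; y1]) (E [set y0'; y1']), f <> 0 ->
    forall S, is_arc Z S ->
    factors_through f (E S) <->
    exists s0 s1, [/\ S = [set s0; s1], cyc3_le y0 s0 y0' & cyc3_le y1 s1 y1'];
  dcc_triangle : forall y0 y1 y0' y1',
    is_arc Z [set y0; y1] -> is_arc Z [set y0'; y1'] ->
    cyc4 y0 y0' y1 y1' ->
    forall f : Hom (E [set y0; y1]) (susp (E [set y0'; y1'])), f <> 0 ->
    exists (X W S : T) (i1 : Hom X S) (i2 : Hom W S)
           (p1 : Hom S X) (p2 : Hom S W)
           (u : Hom (E [set y0'; y1']) S) (v : Hom S (E [set y0; y1])),
      [/\ arc_or_zero [set y0; y0'] X, arc_or_zero [set y1; y1'] W,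
          is_biproduct i1 i2 p1 p2, dist u v f
        & (~ is_zero X -> p1 \oC u <> 0 /\ v \oC i1 <> 0) /\
          (~ is_zero W -> p2 \oC u <> 0 /\ v \oC i2 <> 0)] }.

End DiscreteCluster.

(* The set {1, ..., n} is represented by 'I_n = {0, ..., n - 1}. *)
Definition noncrossing_partition (n : nat) (P : {set {set 'I_n}}) : Prop :=
  finset.partition P [set: 'I_n]%SET /\
  forall (i k j l : 'I_n) (B B' : {set 'I_n}),
    (i < k < j)%N && (j < l)%N -> B \in P -> B' \in P ->
    i \in B -> j \in B -> k \in B' -> l \in B' -> B = B'.

Definition refines (n : nat) (P P' : {set {set 'I_n}}) : Prop :=
  forall B, B \in P -> exists2 B', B' \in P' & B \subset B'.

Section Lattices.
Context {T : Type}.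
Variables (D : set T) (le : T -> T -> Prop).

Definition is_top_in (t : T) : Prop := D t /\ forall x, D x -> le x t.
Definition is_bottom_in (b : T) : Prop := D b /\ forall x, D x -> le b x.

Definition is_meet_in (x y m : T) : Prop :=
  [/\ D m, le m x, le m y
    & forall z, D z -> le z x -> le z y -> le z m].

Definition is_join_in (x y j : T) : Prop :=
  [/\ D j, le x j, le y j
    & forall z, D z -> le x z -> le y z -> le j z].

Record is_lattice : Prop := IsLattice {
  lattice_refl : forall x, D x -> le x x;
  lattice_anti : forall x y, D x -> D y -> le x y -> le y x -> x = y;
  lattice_trans : forall x y z, D x -> D y -> D z -> le x y -> le y z -> le x z;
  lattice_meet : forall x y, D x -> D y -> exists m, is_meet_in x y m;
  lattice_join : forall x y, D x -> D y -> exists j, is_join_in x y j }.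

End Lattices.

(* An order isomorphism of lattices preserves meets and joins. *)
Definition lattice_isomorphic (T T' : Type)
    (D : set T) (le : T -> T -> Prop) (D' : set T') (le' : T' -> T' -> Prop) :=
  [/\ is_lattice D le, is_lattice D' le'
    & exists2 F : T -> T', set_bij D D' F &
        forall x y, D x -> D y -> le x y <-> le' (F x) (F y)].

(* Main.v *)
(* A torsion pair is determined by the arcs of its aisle, and a set of arcs comes
   from a torsion pair only if it contains every arc A such that each arc crossing
   A is crossed by an arc of the set.  Number the segments of the circle between
   consecutive limit points by 0, ..., n - 1 and enumerate each of them by the
   integers.  For a non-degenerate aisle, the Ptolemy property of crossing arcs and
   the closure under suspension, which moves endpoints down, leave only the sets of
   arcs with both endpoints (p, i), (q, j) below heights x_p, x_q and p, q in the same
   block of a non-crossing partition P.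
   Conversely each pair (P, x) gives a t-structure: the approximation of an arc
   {a, b} by the arcs of one block has at most one indecomposable summand {s, t},
   whose ends are the last admissible vertices before a^+ and b^+; its cone is the
   suspension of {s, a^+} + {t, b^+}, and arcs of distinct blocks never cross, so
   the approximations for the blocks can be added up.
   Equivalence forgets x, and inclusion of aisles up to equivalence is refinement. *)

(* Hom spaces and triangles are only known for pairs of arcs, so orthogonality and approximation
   have to be reduced to crossing. The two halves of a torsion pair are each other's orthogonals: an
   arc lies in the coaisle exactly when no arc of the aisle crosses its desuspension, and the aisle
   is recovered from these uncrossed arcs. This is the closure condition [aa_nc], from which the
   Ptolemy property follows. Non-degeneracy enters through the short arcs {(p, k), (p, k + 2)}. One
   of them is outside the aisle, which bounds the heights over p; one of them is crossed by an arc
   of the aisle, which must end at (p, k + 1), so every segment is met. Conversely, an arc outside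
   the set given by (P, x) has to cross some arc that the set leaves uncrossed. It is found either
   inside one segment, at or above the height x_p, or as a chord just above the heights that
   separates two blocks; such a chord exists because P is non-crossing. *)
Require Import Defs.
From HB Require Import structures.
From mathcomp Require Import all_boot all_order all_algebra.
From mathcomp Require Import all_classical all_reals all_analysis.
From mathcomp Require Import finmap zify ring lra.
Import Defs.
Set Implicit Arguments.
Unset Strict Implicit.
Unset Printing Implicit Defensive.
Import Order.TTheory GRing.Theory Num.Theory.
Import numFieldNormedType.Exports.
Local Open Scope classical_set_scope.
Local Open Scope ring_scope.

(** * Triangulated categories *)

Section LinearCategoryTheory.
Variables (K : fieldType) (C : klinear_category K).
Implicit Types X Y Z S : C.

Lemma mcompDl X Y Z (f : Hom X Y) (g g' : Hom Y Z) :
  (g + g') \oC f = g \oC f + g' \oC f.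
Proof. by have := mcomp_linearl f 1 g g'; rewrite !scale1r. Qed.

Lemma mcompDr X Y Z (g : Hom Y Z) (f f' : Hom X Y) :
  g \oC (f + f') = g \oC f + g \oC f'.
Proof. by have := mcomp_linearr g 1 f f'; rewrite !scale1r. Qed.

Lemma mcomp0l X Y Z (f : Hom X Y) : (0 : Hom Y Z) \oC f = 0.
Proof. by apply: (@addrI _ (0 \oC f)); rewrite -mcompDl !addr0. Qed.

Lemma mcomp0r X Y Z (g : Hom Y Z) : g \oC (0 : Hom X Y) = 0.
Proof. by apply: (@addrI _ (g \oC 0)); rewrite -mcompDr !addr0. Qed.

Lemma mcompNl X Y Z (f : Hom X Y) (g : Hom Y Z) : (- g) \oC f = - (g \oC f).
Proof. by apply: (@addrI _ (g \oC f)); rewrite -mcompDl !subrr mcomp0l. Qed.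

Lemma mcompNr X Y Z (f : Hom X Y) (g : Hom Y Z) : g \oC (- f) = - (g \oC f).
Proof. by apply: (@addrI _ (g \oC f)); rewrite -mcompDr !subrr mcomp0r. Qed.

Lemma mcompBl X Y Z (f : Hom X Y) (g g' : Hom Y Z) :
  (g - g') \oC f = g \oC f - g' \oC f.
Proof. by rewrite mcompDl mcompNl. Qed.

Lemma mcompBr X Y Z (g : Hom Y Z) (f f' : Hom X Y) :
  g \oC (f - f') = g \oC f - g \oC f'.
Proof. by rewrite mcompDr mcompNr. Qed.

Lemma is_zero_to X Y (f : Hom X Y) : is_zero Y -> f = 0.
Proof. by move=> Y0; rewrite -(mcomp1m f) Y0 mcomp0l. Qed.

Lemma is_zero_from X Y (f : Hom X Y) : is_zero X -> f = 0.
Proof. by move=> X0; rewrite -(mcompm1 f) X0 mcomp0r. Qed.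

Lemma is_iso_idm X : is_iso (idm X).
Proof. by exists (idm X); rewrite mcomp1m. Qed.

Lemma isomorphic_refl X : isomorphic X X.
Proof. by exists (idm X); exact: is_iso_idm. Qed.

Lemma isomorphic_sym X Y : isomorphic X Y -> isomorphic Y X.
Proof. by move=> [f [g [gf fg]]]; exists g, f. Qed.

Lemma is_iso_comp X Y Z (f : Hom X Y) (g : Hom Y Z) :
  is_iso f -> is_iso g -> is_iso (g \oC f).
Proof.
move=> [f' [ff' f'f]] [g' [gg' g'g]]; exists (f' \oC g'); split.
  by rewrite mcompA -(mcompA f') gg' mcompm1.
by rewrite mcompA -(mcompA g) f'f mcompm1.
Qed.

Lemma isomorphic_trans X Y Z : isomorphic X Y -> isomorphic Y Z -> isomorphic X Z.
Proof. by move=> [f fi] [g gi]; exists (g \oC f); exact: is_iso_comp. Qed.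

Lemma isomorphic_zero X Y : isomorphic X Y -> is_zero X -> is_zero Y.
Proof.
move=> [f [g [gf fg]]] X0.
by rewrite /is_zero -fg (is_zero_from f X0) mcomp0l.
Qed.

Lemma is_direct_sum_zero X Y Z : is_zero Z -> isomorphic X Y ->
  is_direct_sum X Z Y.
Proof.
move=> Z0 [f [g [gf fg]]]; exists f, 0, g, 0; split=> //.
- by rewrite mcomp0r Z0.
- by rewrite mcomp0r.
- by rewrite mcomp0l.
- by rewrite mcomp0r addr0.
Qed.

Lemma is_direct_sum_iso X Y S X' Y' S' : isomorphic X X' -> isomorphic Y Y' ->
  isomorphic S S' -> is_direct_sum X Y S -> is_direct_sum X' Y' S'.
Proof.
move=> [a [a' [aa' a'a]]] [b [b' [bb' b'b]]] [c [c' [cc' c'c]]].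
move=> [i1 [i2 [p1 [p2 [h1 h2 h3 h4 h5]]]]].
exists (c \oC i1 \oC a'), (c \oC i2 \oC b'), (a \oC p1 \oC c'), (b \oC p2 \oC c').
split.
- by rewrite !mcompA -(mcompA _ c' c) cc' mcompm1 -(mcompA a) h1 mcompm1.
- by rewrite !mcompA -(mcompA _ c' c) cc' mcompm1 -(mcompA b) h2 mcompm1.
- by rewrite !mcompA -(mcompA _ c' c) cc' mcompm1 -(mcompA a) h3 mcomp0r mcomp0l.
- by rewrite !mcompA -(mcompA _ c' c) cc' mcompm1 -(mcompA b) h4 mcomp0r mcomp0l.
have -> : c \oC i1 \oC a' \oC (a \oC p1 \oC c') = c \oC (i1 \oC p1) \oC c'.
  by rewrite !mcompA -(mcompA _ a' a) aa' mcompm1.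
have -> : c \oC i2 \oC b' \oC (b \oC p2 \oC c') = c \oC (i2 \oC p2) \oC c'.
  by rewrite !mcompA -(mcompA _ b' b) bb' mcompm1.
by rewrite -mcompDl -mcompDr h5 mcompm1 c'c.
Qed.

(** The idempotent of a summand or its complement is invertible, and an invertible idempotent forces
    the complementary summand to vanish. *)
Lemma local_indecomposable X : local_endomorphism_ring X -> indecomposable X.
Proof.
move=> [X0 loc]; split=> // Y Y' [i1 [i2 [p1 [p2 [h1 h2 h3 h4 h5]]]]].
case: (loc (i1 \oC p1)) => [[g [ge eg]]|[g [ge eg]]].
  right; rewrite /is_zero -h2 -(mcompm1 p2) -eg.
  by rewrite !mcompA h4 !mcomp0l.
left; rewrite /is_zero -h1 -(mcompm1 p1) -eg.
by rewrite mcompA mcompBr mcompm1 mcompA h1 mcomp1m subrr !mcomp0l.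
Qed.

Definition hom_zero X Y : Prop := forall f : Hom X Y, f = 0.

Lemma hom_zero_isol X X' Y : isomorphic X X' -> hom_zero X Y -> hom_zero X' Y.
Proof.
move=> [a [b [ba ab]]] h f.
by rewrite -(mcompm1 f) -ab mcompA (h (f \oC a)) mcomp0l.
Qed.

Lemma hom_zero_isor X Y Y' : isomorphic Y Y' -> hom_zero X Y -> hom_zero X Y'.
Proof.
move=> [a [b [ba ab]]] h f.
by rewrite -(mcomp1m f) -ab -mcompA (h (b \oC f)) mcomp0r.
Qed.

Lemma hom_zero_suml X X' S Y : is_direct_sum X X' S ->
  hom_zero S Y <-> hom_zero X Y /\ hom_zero X' Y.
Proof.
move=> [i1 [i2 [p1 [p2 [h1 h2 h3 h4 h5]]]]]; split=> [h|[h h'] f].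
  split=> f; first by rewrite -(mcompm1 f) -h1 mcompA (h (f \oC p1)) mcomp0l.
  by rewrite -(mcompm1 f) -h2 mcompA (h (f \oC p2)) mcomp0l.
by rewrite -(mcompm1 f) -h5 mcompDr !mcompA (h (f \oC i1)) (h' (f \oC i2)) !mcomp0l addr0.
Qed.

Lemma hom_zero_sumr X Y Y' S : is_direct_sum Y Y' S ->
  hom_zero X S <-> hom_zero X Y /\ hom_zero X Y'.
Proof.
move=> [i1 [i2 [p1 [p2 [h1 h2 h3 h4 h5]]]]]; split=> [h|[h h'] f].
  split=> f; first by rewrite -(mcomp1m f) -h1 -mcompA (h (i1 \oC f)) mcomp0r.
  by rewrite -(mcomp1m f) -h2 -mcompA (h (i2 \oC f)) mcomp0r.
by rewrite -(mcomp1m f) -h5 mcompDl -!mcompA (h (p1 \oC f)) (h' (p2 \oC f)) !mcomp0r addr0.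
Qed.

Definition right_perp (P : set C) : set C := [set Y | forall X, P X -> hom_zero X Y].
Definition left_perp (P : set C) : set C := [set X | forall Y, P Y -> hom_zero X Y].

Lemma right_perp_subcategory P : is_subcategory (right_perp P).
Proof.
split.
- by move=> Y Y0 X _ f; exact: is_zero_to.
- move=> Y Y' S sum hY hY' X PX; apply/(hom_zero_sumr _ sum).
  by split; [exact: hY|exact: hY'].
- move=> Y Y' S sum hS; split=> X PX;
    by have /(hom_zero_sumr _ sum)[] := hS X PX.
Qed.

Lemma left_perp_subcategory P : is_subcategory (left_perp P).
Proof.
split.
- by move=> Y Y0 X _ f; exact: is_zero_from.
- move=> Y Y' S sum hY hY' X PX; apply/(hom_zero_suml _ sum).
  by split; [exact: hY|exact: hY'].
- move=> Y Y' S sum hS; split=> X PX;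
    by have /(hom_zero_suml _ sum)[] := hS X PX.
Qed.

End LinearCategoryTheory.

Section TriangulatedTheory.
Variables (K : fieldType) (T : triangulated_category K).
Implicit Types X Y Z S : T.

Lemma suspmD X Y (f g : Hom X Y) : suspm (f + g) = suspm f + suspm g.
Proof. by have := suspm_linear 1 f g; rewrite !scale1r. Qed.

Lemma suspm0 X Y : suspm (0 : Hom X Y) = 0.
Proof. by apply: (@addrI _ (suspm 0)); rewrite -suspmD !addr0. Qed.

Lemma suspm_inj X Y : injective (@suspm _ T X Y).
Proof. exact: bij_inj (suspm_bij X Y). Qed.

Lemma suspm_surj X Y (g : Hom (susp X) (susp Y)) : exists f, suspm f = g.
Proof. by have [s sK Ks] := suspm_bij X Y; exists (s g). Qed.

Lemma suspm_eq0 X Y (f : Hom X Y) : suspm f = 0 -> f = 0.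
Proof. by rewrite -(suspm0 X Y) => /suspm_inj. Qed.

Lemma hom_zero_susp X Y : hom_zero (susp X) (susp Y) <-> hom_zero X Y.
Proof.
split=> h f; first exact: (suspm_eq0 (h _)).
by have [g <-] := suspm_surj f; rewrite (h g) suspm0.
Qed.

Lemma susp_isomorphic X Y : isomorphic (susp X) (susp Y) <-> isomorphic X Y.
Proof.
split=> [[f [g [gf fg]]]|[f [g [gf fg]]]].
  have [f' ff'] := suspm_surj f; have [g' gg'] := suspm_surj g.
  by exists f', g'; split; apply: suspm_inj; rewrite suspmM suspm1 ff' gg'.
by exists (suspm f), (suspm g); rewrite -!suspmM gf fg !suspm1.
Qed.

Lemma susp_zero X : is_zero (susp X) <-> is_zero X.
Proof.
rewrite /is_zero -suspm1; split=> [/suspm_eq0//|->]; exact: suspm0.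
Qed.

Lemma susp_direct_sum X Y S :
  is_direct_sum (susp X) (susp Y) (susp S) <-> is_direct_sum X Y S.
Proof.
split=> [|] [i1 [i2 [p1 [p2 [h1 h2 h3 h4 h5]]]]].
  have [j1 e1] := suspm_surj i1; have [j2 e2] := suspm_surj i2.
  have [q1 e3] := suspm_surj p1; have [q2 e4] := suspm_surj p2.
  subst i1 i2 p1 p2; exists j1, j2, q1, q2.
  by split; apply: suspm_inj; rewrite ?suspmD ?suspmM ?suspm1 ?suspm0.
exists (suspm i1), (suspm i2), (suspm p1), (suspm p2).
by split; rewrite -!suspmM ?h1 ?h2 ?h3 ?h4 -?suspmD ?h5 ?suspm1 ?suspm0.
Qed.

Lemma subcategory_iso (P : set T) X Y :
  is_subcategory P -> isomorphic X Y -> P X -> P Y.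
Proof.
move=> [P0 PD _] XY PX; have [[N N0] _] := tcat_additive T.
exact: PD (is_direct_sum_zero N0 XY) PX (P0 _ N0).
Qed.

Lemma dist_comp0 X Y Z (f : Hom X Y) (g : Hom Y Z) (h : Hom Z (susp X)) :
  dist f g h -> g \oC f = 0.
Proof.
move=> fgh; have [[N N0] _] := tcat_additive T.
have [|c [<- _]] := dist_morphism (a := idm X) (b := f) (dist_id X N0) fgh.
  by [].
exact: mcomp0r.
Qed.

(** Complete [u] and the zero map to a morphism from the rotated identity triangle of [S] to the
    rotated given triangle; its third component desuspends to the factorization. *)
Lemma dist_exact X Y Z (f : Hom X Y) (g : Hom Y Z) (h : Hom Z (susp X)) S
  (u : Hom S Y) : dist f g h -> g \oC u = 0 -> exists v, u = f \oC v.
Proof.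
move=> /dist_rotate fgh gu; have [[N N0] _] := tcat_additive T.
have /dist_rotate tS := dist_id S N0.
have [|c [_ e]] := dist_morphism (a := u) (b := 0) tS fgh.
  by rewrite gu mcomp0l.
have [v vc] := suspm_surj c; exists v; apply: suspm_inj.
rewrite suspmM vc; apply: oppr_inj.
by rewrite -mcompNl -e suspm1 mcompNr mcompm1.
Qed.

Lemma dist_exact2 X Y Z (f : Hom X Y) (g : Hom Y Z) (h : Hom Z (susp X)) S
  (u : Hom S Z) : dist f g h -> h \oC u = 0 -> exists v, u = g \oC v.
Proof. by move=> /dist_rotate fgh; exact: dist_exact fgh. Qed.

Lemma dist_exact3 X Y Z (f : Hom X Y) (g : Hom Y Z) (h : Hom Z (susp X)) S
  (u : Hom S (susp X)) :
  dist f g h -> suspm f \oC u = 0 -> exists v, u = h \oC v.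
Proof.
move=> /dist_rotate/dist_rotate fgh fu; apply: dist_exact fgh _.
by rewrite mcompNl fu oppr0.
Qed.

(** The complement is the cone of [i]: as [suspm i] is a split monomorphism, the connecting morphism
    is zero and [g] has a section [c]. Subtracting [i \oC (p \oC c)] turns it into a section killed
    by [p]. *)
Lemma retract_direct_summand X Y (i : Hom X Y) (p : Hom Y X) :
  p \oC i = idm X -> exists X', is_direct_sum X X' Y.
Proof.
move=> pi; have [Z [g [h igh]]] := dist_complete i.
have h0 : h = 0.
  have ih : suspm i \oC h = 0.
    move: igh => /dist_rotate/dist_rotate/dist_comp0.
    by rewrite mcompNl => /eqP; rewrite oppr_eq0 => /eqP.
  by rewrite -(mcomp1m h) -suspm1 -pi suspmM -mcompA ih mcomp0r.
have [|c gc] := @dist_exact2 _ _ _ _ _ _ Z (idm Z) igh; first by rewrite h0 mcomp0l.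
have gi := dist_comp0 igh.
pose j := c - i \oC (p \oC c).
have gj : g \oC j = idm Z by rewrite mcompBr mcompA gi mcomp0l subr0.
have pj : p \oC j = 0 by rewrite mcompBr mcompA pi mcomp1m subrr.
exists Z, i, j, p, g; split=> //.
pose e := idm Y - (i \oC p + j \oC g).
have [|t et] := dist_exact (u := e) igh.
  by rewrite mcompBr mcompDr !mcompA gi gj mcomp0l add0r mcomp1m mcompm1 subrr.
have pe : p \oC e = 0.
  by rewrite mcompBr mcompDr !mcompA pi pj mcomp0l mcomp1m mcompm1 addr0 subrr.
have t0 : t = 0 by rewrite -(mcomp1m t) -pi -mcompA -et pe.
by move: et; rewrite t0 mcomp0r => /eqP; rewrite subr_eq0 => /eqP.
Qed.

(* Surjectivity of [Hom(S, f)] and injectivity of [Hom(S, susp f)] for [S] in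
   [Q]: by the long exact sequence this says that the cone of [f] is right
   orthogonal to [Q], and unlike a triangle it is inherited by direct sums. *)
Definition approximation (Q : set T) X Z (f : Hom X Z) : Prop :=
  forall S, Q S -> (forall g : Hom S Z, exists h, g = f \oC h) /\
    (forall u : Hom S (susp X), suspm f \oC u = 0 -> u = 0).

Lemma approximation_cone (Q : set T) X Z W (f : Hom X Z) (g : Hom Z W)
    (h : Hom W (susp X)) :
  dist f g h -> approximation Q f <-> right_perp Q W.
Proof.
move=> fgh; split=> [app S QS u|QW S QS].
  have [surj inj] := app S QS.
  have fh : suspm f \oC h = 0.
    move: fgh => /dist_rotate/dist_rotate/dist_comp0.
    by rewrite mcompNl => /eqP; rewrite oppr_eq0 => /eqP.
  have [|v ->] := dist_exact2 (u := u) fgh.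
    by apply: inj; rewrite mcompA fh mcomp0l.
  have [w ->] := surj v.
  by rewrite mcompA (dist_comp0 fgh) mcomp0l.
split=> [u|u fu].
  by apply: (dist_exact fgh); exact: QW.
have [v ->] := dist_exact3 fgh fu.
by rewrite (QW _ QS v) mcomp0r.
Qed.

Lemma approximation_sum (Q : set T) X Z (f : Hom X Z) X' Z' (f' : Hom X' Z') W :
  is_direct_sum Z Z' W -> approximation Q f -> approximation Q f' ->
  exists (V : T) (g : Hom V W), is_direct_sum X X' V /\ approximation Q g.
Proof.
move=> [j1 [j2 [q1 [q2 [k1 k2 k3 k4 k5]]]]] af af'.
have [V sumV] := (tcat_additive T).2 X X'.
have [i1 [i2 [p1 [p2 [h1 h2 h3 h4 h5]]]]] := sumV.
exists V, (j1 \oC f \oC p1 + j2 \oC f' \oC p2); split=> // S QS.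
have [s1 n1] := af S QS; have [s2 n2] := af' S QS; split=> [u|u].
  have [v1 e1] := s1 (q1 \oC u); have [v2 e2] := s2 (q2 \oC u).
  exists (i1 \oC v1 + i2 \oC v2).
  rewrite mcompDl !mcompDr !mcompA -!(mcompA _ p1) -!(mcompA _ p2).
  rewrite h1 h2 h3 h4 !mcomp0r !mcompm1 !mcomp0l addr0 add0r.
  by rewrite -!mcompA -e1 -e2 !mcompA -mcompDl k5 mcomp1m.
rewrite suspmD !suspmM => e.
have e1 : suspm p1 \oC u = 0.
  apply: n1; have := congr1 (fun z => suspm q1 \oC z) e.
  rewrite mcomp0r mcompDl mcompDr !mcompA -(suspmM q1 j1) -(suspmM q1 j2).
  by rewrite k1 k3 suspm1 suspm0 !mcomp0l addr0 mcomp1m.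
have e2 : suspm p2 \oC u = 0.
  apply: n2; have := congr1 (fun z => suspm q2 \oC z) e.
  rewrite mcomp0r mcompDl mcompDr !mcompA -(suspmM q2 j1) -(suspmM q2 j2).
  by rewrite k2 k4 suspm1 suspm0 !mcomp0l add0r mcomp1m.
rewrite -(mcomp1m u) -suspm1 -h5 suspmD !suspmM mcompDl -!mcompA e1 e2.
by rewrite !mcomp0r addr0.
Qed.

(** An object of [Q] maps to [Z] through [X] alone, and the vanishing of its maps to [susp X']
    leaves only the component in [susp X] for the injectivity; symmetrically for [Q']. This is how
    approximations for different blocks are added. *)
Lemma approximation_union (Q Q' : set T) X X' Z (f : Hom X Z) (f' : Hom X' Z) :
  approximation Q f -> approximation Q' f' ->
  (forall S, Q S -> hom_zero S (susp X')) ->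
  (forall S, Q' S -> hom_zero S (susp X)) ->
  exists (V : T) (g : Hom V Z), is_direct_sum X X' V /\ approximation (Q `|` Q') g.
Proof.
move=> af af' QX' Q'X.
have [V sumV] := (tcat_additive T).2 X X'.
have [i1 [i2 [p1 [p2 [h1 h2 h3 h4 h5]]]]] := sumV.
exists V, (f \oC p1 + f' \oC p2); split=> // S QS; split=> [u|u].
  case: QS => [/af|/af'] [sf _]; have [v ->] := sf u.
    exists (i1 \oC v).
    by rewrite mcompDl !mcompA -!(mcompA _ _ i1) h1 h4 mcompm1 mcomp0r mcomp0l addr0.
  exists (i2 \oC v).
  by rewrite mcompDl !mcompA -!(mcompA _ _ i2) h2 h3 mcompm1 mcomp0r mcomp0l add0r.
rewrite suspmD !suspmM mcompDl -!mcompA => e.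
have [e1 e2] : suspm p1 \oC u = 0 /\ suspm p2 \oC u = 0.
  case: QS => [QS|Q'S].
    have e2 := QX' _ QS (suspm p2 \oC u); split=> //.
    by apply: (af _ QS).2; rewrite e2 mcomp0r addr0 in e.
  have e1 := Q'X _ Q'S (suspm p1 \oC u); split=> //.
  by apply: (af' _ Q'S).2; rewrite e1 mcomp0r add0r in e.
rewrite -(mcomp1m u) -suspm1 -h5 suspmD !suspmM mcompDl -!mcompA e1 e2.
by rewrite !mcomp0r addr0.
Qed.

Lemma approximation_iso (Q : set T) X Z Z' (f : Hom X Z) (a : Hom Z Z') :
  is_iso a -> approximation Q f -> approximation Q (a \oC f).
Proof.
move=> [b [ba ab]] af S QS; have [sf nf] := af S QS; split=> [u|u].
  have [v bv] := sf (b \oC u); exists v.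
  by rewrite -mcompA -bv mcompA ab mcomp1m.
rewrite suspmM -mcompA => e; apply: nf.
by rewrite -(mcomp1m (suspm f)) -suspm1 -ba suspmM -!mcompA e mcomp0r.
Qed.

Lemma approximation_zero (Q : set T) X Z :
  is_zero X -> right_perp Q Z -> approximation Q (0 : Hom X Z).
Proof.
move=> X0 QZ S QS; split=> [u|u _]; last by apply: is_zero_to; apply/susp_zero.
by exists 0; rewrite mcomp0r (QZ _ QS u).
Qed.

(** If the aisle part of the triangle of [Z] maps to [Z] by zero, then [Z] is a retract of the
    coaisle part, and dually; closure under summands concludes. *)
Lemma torsion_pair_perp (t : set T * set T) : is_torsion_pair t ->
  t.2 = right_perp t.1 /\ t.1 = left_perp t.2.
Proof.
case: t => P Q [/= subP subQ PQ dec]; split; apply/seteqP; split=> [Y QY X PX|Z hZ].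
- exact: PQ.
- have [X [Y [f [g [h [PX QY fgh]]]]]] := dec Z.
  have f0 : f = 0 by exact: hZ.
  (* With [f] zero, [h] has a section [s], and the complementary idempotent [idm Y - s \oC h]
     factors as [g \oC r]; this [r] is the retraction of [g]. *)
  have [|s hs] := dist_exact3 (u := idm (susp X)) fgh.
    by rewrite f0 suspm0 mcomp0l.
  have [|r gr] := dist_exact2 (u := idm Y - s \oC h) fgh.
    by rewrite mcompBr mcompm1 mcompA -hs mcomp1m subrr.
  have rg : r \oC g = idm Z.
    apply/eqP; rewrite -subr_eq0; apply/eqP.
    have [|v ->] := dist_exact (u := r \oC g - idm Z) fgh.
      rewrite mcompBr mcompA -gr mcompBl mcomp1m mcompm1 -mcompA.
      have hg : h \oC g = 0 by move/dist_rotate: fgh => /dist_comp0.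
      by rewrite hg mcomp0r subr0 subrr.
    by rewrite f0 mcomp0l.
  have [Z' sum] := retract_direct_summand rg.
  by case: subQ => _ _ /(_ _ _ _ sum QY)[].
- exact: PQ.
- have [X [Y [f [g [h [PX QY fgh]]]]]] := dec Z.
  have [|s fs] := dist_exact (u := idm Z) fgh.
    by rewrite (hZ _ QY g) mcomp0l.
  have [Z' sum] := retract_direct_summand (esym fs).
  by case: subP => _ _ /(_ _ _ _ sum PX)[].
Qed.

Lemma approximation_torsion_pair (Q : set T) :
  (forall Z, exists (X : T) (f : Hom X Z),
     left_perp (right_perp Q) X /\ approximation Q f) ->
  is_torsion_pair (left_perp (right_perp Q), right_perp Q).
Proof.
move=> app; split=> /=.
- exact: left_perp_subcategory.
- exact: right_perp_subcategory.
- by move=> X Y PX QY f; exact: PX.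
move=> Z; have [X [f [PX af]]] := app Z.
have [Y [g [h fgh]]] := dist_complete f.
by exists X, Y, f, g, h; split=> //; exact/(approximation_cone _ fgh).
Qed.

Lemma iter_susp_isomorphic m X Y :
  isomorphic (iter m susp X) (iter m susp Y) <-> isomorphic X Y.
Proof. by elim: m => //= m IH; rewrite susp_isomorphic. Qed.

Lemma iter_susp_direct_sum m X Y S :
  is_direct_sum (iter m susp X) (iter m susp Y) (iter m susp S) <->
  is_direct_sum X Y S.
Proof. by elim: m => //= m IH; rewrite susp_direct_sum. Qed.

Lemma iter_susp_zero m X : is_zero (iter m susp X) <-> is_zero X.
Proof. by elim: m => //= m IH; rewrite susp_zero. Qed.

Lemma iter_susp_surj m Y : exists X, isomorphic Y (iter m (@susp _ T) X).
Proof.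
elim: m Y => [|m IH] Y; first by exists Y; exact: isomorphic_refl.
have [X XY] := susp_surj Y; have [W XW] := IH X; exists W => /=.
by apply: isomorphic_trans (isomorphic_sym XY) _; exact/susp_isomorphic.
Qed.

Lemma susp_sub_subcategory k (P : set T) :
  is_subcategory P -> is_subcategory (susp_sub k P).
Proof.
move=> subP; have [P0 PD PS] := subP.
case: k => m /=; split.
- move=> X X0; have [Y XY] := iter_susp_surj m X; exists Y => //.
  by apply: P0; apply/(iter_susp_zero m); exact: isomorphic_zero XY X0.
- move=> X X' S sum [Y PY XY] [Y' PY' XY'].
  have [W SW] := iter_susp_surj m S; exists W => //.
  apply: PD PY PY'; apply/(iter_susp_direct_sum m).
  exact: is_direct_sum_iso sum.
- move=> X X' S sum [W PW SW].
  have [Y XY] := iter_susp_surj m X; have [Y' XY'] := iter_susp_surj m X'.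
  have [PY PY'] : P Y /\ P Y'.
    apply: PS PW; apply/(iter_susp_direct_sum m).
    exact: is_direct_sum_iso sum.
  by split; [exists Y|exists Y'].
- by move=> X X0; apply: P0; apply/(iter_susp_zero m.+1).
- move=> X X' S sum PX PX'; apply: PD PX PX'.
  exact/(iter_susp_direct_sum m.+1).
- move=> X X' S sum; apply: PS; exact/(iter_susp_direct_sum m.+1).
Qed.

End TriangulatedTheory.

(** * Admissible subsets of the circle *)

Section CircleAngles.
Variable R : realType.
Implicit Types (s t b c : R) (k : int) (x y z : R * R).

Lemma circle_pointDnat t (m : nat) : circle_point (t + pi *+ 2 *+ m) = circle_point t.
Proof.
by rewrite /circle_point (periodicn (@cosD2pi R)) (periodicn (@sinD2pi R)).
Qed.

Lemma circle_pointDint t k : circle_point (t + pi *+ 2 *~ k) = circle_point t.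
Proof.
case: k => m; first by rewrite -pmulrn circle_pointDnat.
rewrite NegzE mulrNz -pmulrn -(circle_pointDnat (t - _) m.+1).
by rewrite subrK.
Qed.

Lemma circle_point2pi t : circle_point (t + 2 * pi) = circle_point t.
Proof. by rewrite -(circle_pointDint t 1) mulr_natl. Qed.

Lemma angle_reduce b t : exists k, b <= t + pi *+ 2 *~ k < b + 2 * pi.
Proof.
have pi0 : 0 < pi *+ 2 :> R by rewrite mulrn_wgt0 ?pi_gt0.
exists (- Num.floor ((t - b) / (pi *+ 2))).
set q := (t - b) / (pi *+ 2).
have tq : t = b + q * (pi *+ 2) by rewrite /q divfK ?gt_eqF// addrC subrK.
rewrite mulrNz -mulrzl tq.
have /andP[h1 h2] := floor_itv q.
have h3 : (Num.floor q)%:~R * (pi *+ 2) <= q * (pi *+ 2) by rewrite ler_pM2r.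
have h4 : q * (pi *+ 2) < ((Num.floor q + 1)%:~R) * (pi *+ 2) by rewrite ltr_pM2r.
rewrite intrD mulrDl mul1r in h4.
move: h3 h4; set A := _%:~R * _; set B := q * _ => h3 h4.
apply/andP; split; lra.
Qed.

Lemma ler_2piz k l : k <= l -> pi *+ 2 *~ k <= pi *+ 2 *~ l :> R.
Proof. by move=> kl; rewrite -[leLHS]mulrzl -[leRHS]mulrzl ler_pM2r ?ler_int// mulrn_wgt0 ?pi_gt0. Qed.

Lemma cos_eq1 t : 0 <= t < 2 * pi -> cos t = 1 -> t = 0.
Proof.
move=> /andP[t0 t2]; have p0 := @pi_gt0 R.
have [tpi|tpi] := leP t pi => ct.
  by apply: cos_inj; rewrite ?cos0// !in_itv/= ?t0 ?tpi ?lexx ?pi_ge0.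
have : 2 * pi - t = 0.
  apply: cos_inj; rewrite ?cos0//= ?in_itv/= ?lexx ?pi_ge0//.
    by apply/andP; split; lra.
  by rewrite mulr_natl addrC cosD2pi cosN.
lra.
Qed.

Lemma circle_point_eq s t :
  circle_point s = circle_point t -> exists k, s = t + pi *+ 2 *~ k.
Proof.
move=> [cst sst]; have [k hk] := angle_reduce 0 (s - t).
exists (- k); rewrite mulrNz; apply/eqP; rewrite -subr_eq0 opprD opprK addrA.
apply/eqP/cos_eq1; first by rewrite add0r in hk.
have [-> _] : circle_point (s - t + pi *+ 2 *~ k) = circle_point (s - t).
  exact: circle_pointDint.
by rewrite cosB cst sst -!expr2 cos2Dsin2.
Qed.

Lemma circle_point_inj b s t : b <= s < b + 2 * pi -> b <= t < b + 2 * pi ->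
  circle_point s = circle_point t -> s = t.
Proof.
move=> hs ht /circle_point_eq[k e]; have p0 := @pi_gt0 R.
have [k0|k0|k0] := ltgtP k 0; last by rewrite e k0 mulr0z addr0.
  have /ler_2piz : k <= -1 by clear -k0; lia.
  by rewrite mulrN1z => ?; exfalso; lra.
have /ler_2piz : 1 <= k by clear -k0; lia.
by rewrite mulr1z => ?; exfalso; lra.
Qed.

Lemma circle_angle x : circle x -> exists t, x = circle_point t.
Proof.
case: x => c s; rewrite /circle/= => cs.
have c1 : -1 <= c <= 1.
  by rewrite -ler_norml -(@ler_pXn2r _ 2) ?nnegrE// expr1n real_normK ?num_real//; have := sqr_ge0 s; lra.
have ac : cos (acos c) = c by apply: acosK; rewrite in_itv.
have as' := sin_acos c1.
have e : 1 - c ^+ 2 = s ^+ 2 by lra.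
rewrite e sqrtr_sqr in as'.
have [s0|s0] := leP 0 s.
  by exists (acos c); rewrite /circle_point ac// as' ger0_norm.
exists (- acos c); rewrite /circle_point cosN sinN ac// as'.
by rewrite ltr0_norm// opprK.
Qed.

Lemma circle_angle_from b x : circle x ->
  exists2 t, b <= t < b + 2 * pi & x = circle_point t.
Proof.
move=> /circle_angle[t ->]; have [k hk] := angle_reduce b t.
by exists (t + pi *+ 2 *~ k); rewrite ?circle_pointDint.
Qed.

Lemma int_small_cases k : [\/ k <= -2, k = -1, k = 0 | 1 <= k].
Proof.
have : k <= -2 \/ k = -1 \/ k = 0 \/ 1 <= k by lia.
by move=> [?|[?|[?|?]]]; [constructor 1|constructor 2|constructor 3|constructor 4].
Qed.

Lemma cyc3_circle_point b t1 t2 t3 : b <= t1 < b + 2 * pi ->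
  b <= t2 < b + 2 * pi -> b <= t3 < b + 2 * pi ->
  cyc3 (circle_point t1) (circle_point t2) (circle_point t3) <->
  [|| t1 < t2 < t3, t2 < t3 < t1 | t3 < t1 < t2].
Proof.
move=> h1 h2 h3; have p0 := @pi_gt0 R; split; last first.
  move=> /or3P[] h.
  - by exists t1, t2, t3; split=> //; apply/andP; split; lra.
  - exists (t1 - 2 * pi), t2, t3; split; first by apply/andP; split; lra.
    by split=> //; rewrite -(circle_point2pi (t1 - _)) subrK.
  - exists t1, t2, (t3 + 2 * pi); split; first by apply/andP; split; lra.
    by split=> //; rewrite circle_point2pi.
move=> [a [b' [c [/andP[habc hc]]]]] [].
move=> /circle_point_eq[k e1] /circle_point_eq[l e2] /circle_point_eq[m e3].
(* All given angles lie in one period and so do [a], [b'], [c]; hence the winding numbers relative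
   to [k] are 0 or -1. Of the four combinations three are the rotations of the linear order and one
   contradicts [b' < c]. *)
have small (x : R) (d : int) : 0 < x < 2 * pi ->
    - (2 * pi) < x + pi *+ 2 *~ d < 2 * pi -> d = 0 \/ d = -1.
  move=> hx hd; have [/ler_2piz|->|->|/ler_2piz] := int_small_cases d; [|by right|by left|].
    have -> : pi *+ 2 *~ (-2) = - (4 * pi) :> R by rewrite -mulrzl; ring.
    by move=> ?; exfalso; lra.
  by rewrite mulr1z => ?; exfalso; lra.
have E d : pi *+ 2 *~ (d - k) = pi *+ 2 *~ d - pi *+ 2 *~ k :> R by rewrite mulrzBr.
have dl : l - k = 0 \/ l - k = -1 by apply: (small (b' - a)); rewrite ?E; lra.
have dm : m - k = 0 \/ m - k = -1 by apply: (small (c - a)); rewrite ?E; lra.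
have := E l; have := E m.
case: dl dm => -> [] ->; rewrite ?mulr0z ?mulrN1z => El Em.
- by apply/or3P; constructor 1; lra.
- by apply/or3P; constructor 3; lra.
- by exfalso; lra.
- by apply/or3P; constructor 2; lra.
Qed.

End CircleAngles.

(** * Discrete subsets of an open interval accumulating exactly at both ends *)

Section DiscreteEnumeration.
Variable R : realType.

(** Local isolation makes the infimum of the points above [s] a point of [S], which is the next one.
    Iteration reaches every later point, since otherwise the iterates would accumulate at their
    supremum inside the interval. *)
Lemma discrete_enum_up (S : set R) (a b s0 : R) :
  (forall s, S s -> a < s < b) ->
  (forall c, a < c < b -> exists2 e : R, 0 < e & forall s, S s -> `|s - c| < e -> s = c) ->
  (forall c, a < c < b -> exists2 s, S s & c < s) -> S s0 ->
  exists f : nat -> R, [/\ f 0%N = s0, forall m, S (f m),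
    forall m, f m < f m.+1 & forall s, S s -> s0 <= s -> exists m, f m = s].
Proof.
move=> Sab loc cof Ss0.
have next s : S s -> exists t, [/\ S t, s < t & forall u, S u -> s < u -> t <= u].
  move=> Ss; have /andP[as_ sb] := Sab _ Ss.
  pose A := [set u | S u /\ s < u].
  have [u0 Su0 su0] := cof s (Sab _ Ss).
  have Alb : lbound A s by move=> u [_ /ltW].
  have hA : has_inf A by split; [exists u0|exists s].
  have sm : s <= inf A by apply: lb_le_inf => //; exists u0.
  have mu u : A u -> inf A <= u by move=> Au; apply: ge_inf => //; exists s.
  have mb : inf A < b.
    by have := Sab _ Su0 => /andP[_]; apply: le_lt_trans; exact: mu.
  have [|e e0 he] := loc (inf A); first by rewrite (lt_le_trans as_ sm).
  have [u [Su su] ue] := inf_adherent e0 hA.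
  have uE : u = inf A.
    apply: he => //; rewrite ger0_norm ?subr_ge0; first by rewrite ltrBlDl.
    exact: mu.
  by exists (inf A); rewrite -uE; split=> // v Sv sv; rewrite uE; apply: mu.
pose nx s := xget s [set t | [/\ S t, s < t & forall u, S u -> s < u -> t <= u]].
have nxP s : S s -> [/\ S (nx s), s < nx s & forall u, S u -> s < u -> nx s <= u].
  by move=> Ss; exact: (xgetPex s (next s Ss)).
pose f m := iter m nx s0.
have Sf m : S (f m) by elim: m => //= m /nxP[].
have fS m : f m < f m.+1 by rewrite /f iterS; have [] := nxP _ (Sf m).
exists f; split=> // s Ss s0s; apply: contrapT => nf.
have fs m : f m < s.
  rewrite lt_neqAle; apply/andP; split; first by apply/eqP => fm; apply: nf; exists m.
  elim: m => // m IH; have [_ _] := nxP _ (Sf m); apply=> //.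
  by rewrite lt_neqAle IH andbT; apply/eqP => fm; apply: nf; exists m.
pose A := [set f m | m in setT].
have hA : has_sup A.
  by split; [exists (f 0%N), 0%N|exists s => _ [m _ <-]; exact: ltW].
have fA m : f m <= sup A by apply: sup_upper_bound => //; exists m.
have As : sup A <= s by apply: ge_sup; [exists (f 0%N), 0%N|move=> _ [m _ <-]; exact: ltW].
have [|e e0 he] := loc (sup A).
  have /andP[as0 _] := Sab _ Ss0; have /andP[_ sb] := Sab _ Ss.
  by rewrite (lt_le_trans as0 (fA 0%N)) (le_lt_trans As sb).
have [_ [m _ <-] fe] := sup_adherent e0 hA.
have fmE : f m = sup A.
  apply: he => //; rewrite ler0_norm ?subr_le0//; lra.
by have := fS m; rewrite fmE ltNge fA.
Qed.

Lemma discrete_enum (S : set R) (a b : R) : a < b ->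
  (forall s, S s -> a < s < b) ->
  (forall c, a < c < b -> exists2 e : R, 0 < e & forall s, S s -> `|s - c| < e -> s = c) ->
  (forall c, a < c < b -> exists2 s, S s & c < s) ->
  (forall c, a < c < b -> exists2 s, S s & s < c) ->
  exists f : int -> R, [/\ forall i, S (f i), {homo f : i j / i < j} &
    forall s, S s -> exists i, f i = s].
Proof.
move=> ab Sab loc up down.
have [|s0 Ss0 _] := up ((a + b) / 2); first by apply/andP; split; lra.
have [f [f0 Sf fS fs]] := discrete_enum_up Sab loc up Ss0.
(* The reflected set is enumerated upwards to enumerate [S] downwards. *)
have [|||| g [g0 Sg gS gs]] := @discrete_enum_up [set s | S (- s)] (- b) (- a) (- s0).
- by move=> s /= /Sab; lra.
- move=> c hc; have [|e e0 he] := loc (- c); first by lra.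
  exists e => // s /= Ss sc; apply: oppr_inj; apply: he => //.
  by rewrite -opprD normrN.
- move=> c hc; have [|s Ss sc] := down (- c); first by lra.
  by exists (- s); rewrite /= ?opprK//; lra.
- by rewrite /= opprK.
(* Both enumerations start at [s0], so the negative half begins with index 1 of [g]. *)
pose F (i : int) := match i with Posz m => f m | Negz m => - g m.+1 end.
have FS i : F i < F (i + 1).
  case: i => [m|[|m]].
  - by rewrite -PoszD addn1 /= fS.
  - by rewrite /= f0; have := gS 0%N; rewrite g0; lra.
  - have -> : Negz m.+1 + 1 = Negz m by clear; lia.
    by rewrite /=; have := gS m.+1; lra.
exists F; split.
- by case=> m //=; exact: Sg.
- have FD i m : F i < F (i + m.+1%:Z).
    elim: m => [|m IH]; first exact: FS.
    by rewrite -addn1 PoszD addrA; exact: lt_trans IH (FS _).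
  move=> i j ij; have -> : j = i + (`|(j - i - 1)%R|%N.+1)%:Z by clear -ij; lia.
  exact: FD.
- move=> s Ss; have [s0s|ss0] := leP s0 s.
    by have [m <-] := fs _ Ss s0s; exists (Posz m).
  have [||m gm] := gs (- s); [by rewrite /= opprK|by lra|].
  by case: m gm => [|m] gm; [lra|exists (Negz m); rewrite /= gm opprK].
Qed.

End DiscreteEnumeration.

Section VertexOrder.
Variable n : nat.
Implicit Types u v w : 'I_n * int.

(** The linear order obtained by cutting the circle at one limit point: segments come first,
    positions within a segment second. *)
Definition vlt u v := (u.1 < v.1)%N || (u.1 == v.1) && (u.2 < v.2).

Definition vcyc u v w :=
  [|| vlt u v && vlt v w, vlt v w && vlt w u | vlt w u && vlt u v].

Lemma vlt_total u v : [\/ vlt u v, u = v | vlt v u].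
Proof.
case: u v => [p i] [q j]; rewrite /vlt/=.
have [pq|qp|/val_inj <-] := ltngtP p q; [by constructor 1|by constructor 3|].
rewrite eqxx/=; have [ij|ji|->] := ltgtP i j;
  by [constructor 1|constructor 3|constructor 2].
Qed.

End VertexOrder.

(** * Coordinates on an admissible set *)

Section CircleModel.
Variables (R : realType) (n : nat) (Z : set (R * R)).
Hypotheses (n0 : (0 < n)%N) (hZ : admissible n Z).

Lemma continuous_circle_point : continuous (@circle_point R).
Proof. move=> t; exact: cvg_pair (@continuous_cos R t) (@continuous_sin R t). Qed.

Lemma angle_isolated c : ~ limit_points Z (circle_point c) ->
  exists2 e : R, 0 < e & forall s, Z (circle_point s) -> `|s - c| < e -> s = c.
Proof.
case: hZ => _ iso _ _ nl; have p0 := @pi_gt0 R.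
have [V nV VZ] : exists2 V, nbhs (circle_point c) V &
    forall z, V z -> Z z -> z = circle_point c.
  have [Zc|nZc] := pselect (Z (circle_point c)).
    have [_ [V nV VZ]] := iso _ Zc; exists V => // z Vz Zz.
    have : (V `&` Z) z by [].
    by rewrite VZ.
  have : ~ closure Z (circle_point c) by move=> cl; apply: nl.
  move=> /existsNP[V /not_implyP[nV /set0P/negP/negPn/eqP ZV]].
  exists V => // z Vz Zz; have : (Z `&` V) z by [].
  by rewrite ZV.
have /nbhs_ballP[e /= e0 eV] := continuous_circle_point nV.
(* Within distance [pi] of [c] an angle is determined by its point on the circle. *)
exists (Num.min e pi); first by rewrite lt_min e0.
move=> s Zs; rewrite lt_min => /andP[se sp].
have : circle_point s = circle_point c.
  by apply: VZ => //; apply: eV; rewrite /ball/= distrC.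
move: sp; rewrite ltr_norml => sp.
by apply: (@circle_point_inj _ (c - pi)); lra.
Qed.

Lemma limit_points_circle x : limit_points Z x -> circle x.
Proof.
by case: hZ => _ _ _ two /two[t -> _]; rewrite /circle/= cos2Dsin2.
Qed.

Lemma limit_point_up t e : limit_points Z (circle_point t) -> 0 < e ->
  exists2 s, Z (circle_point s) & t < s < t + e.
Proof.
case: hZ => _ _ _ two /two[s ts H] e0; have [[d de Zd] _] := H _ e0.
have [k tk] := circle_point_eq ts; exists (t + d); last by lra.
by rewrite -(circle_pointDint _ (- k)) tk mulrNz addrAC addrK.
Qed.

Lemma limit_point_down t e : limit_points Z (circle_point t) -> 0 < e ->
  exists2 s, Z (circle_point s) & t - e < s < t.
Proof.
case: hZ => _ _ _ two /two[s ts H] e0; have [_ [d de Zd]] := H _ e0.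
have [k tk] := circle_point_eq ts; exists (t - d); last by lra.
by rewrite -(circle_pointDint _ (- k)) tk mulrNz addrAC addrK.
Qed.

Lemma limit_angles : exists al : nat -> R,
  [/\ al n = al 0%N + 2 * pi, {homo al : p q / (p < q)%N && (q <= n)%N >-> p < q},
      forall p, (p <= n)%N -> limit_points Z (circle_point (al p))
    & forall t, al 0%N <= t < al n -> limit_points Z (circle_point t) ->
        exists2 p, (p < n)%N & t = al p].
Proof.
have [x Lx] : exists x, limit_points Z x.
  have [_ _ /card_set_bijP[f [_ _ fs]] _] := hZ.
  have [x Lx _] : (f @` limit_points Z) 0%N by apply: fs.
  by exists x.
have [b xb] := circle_angle (limit_points_circle Lx).
have p0 := @pi_gt0 R.
pose A := [set t | b <= t < b + 2 * pi /\ limit_points Z (circle_point t)].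
have Ab : A b by split; [lra|rewrite -xb].
have cA : (A #= `I_n)%card.
  have [_ _ cL _] := hZ; apply: card_eq_trans cL.
  apply/card_set_bijP; exists (@circle_point R); split.
  - by move=> t [].
  - by move=> s t /set_mem[hs _] /set_mem[ht _]; exact: circle_point_inj hs ht.
  - move=> y Ly; have [t ht yt] := circle_angle_from b (limit_points_circle Ly).
    by exists t; rewrite // /A/= -yt.
have fA : finite_set A by apply/finite_setP; exists n.
pose s := sort <=%R (finmap.enum_fset (fset_set A)).
have sA t : (t \in s) = (t \in A).
  by rewrite mem_sort in_fset_set.
have ss : sorted <%R s.
  rewrite lt_sorted_uniq_le sort_uniq finmap.fset_uniq /=.
  exact: sort_le_sorted.
have sz : size s = n.
  rewrite size_sort; apply/eqP; rewrite -[X in X == _]/(size (finmap.enum_fset _)).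
  by apply/eqP/card_eq_fsetP; rewrite fset_setK.
(* The default value of [nth] is the first limit angle after a full turn, so that index [n] closes
   the last segment. *)
have al0 : nth (b + 2 * pi) s 0 = b.
  have : b \in s by rewrite sA; exact/mem_set.
  have : (0 < size s)%N by rewrite sz.
  move=> s0 bs; apply: le_anti; apply/andP; split; last first.
    have : nth (b + 2 * pi) s 0 \in A by rewrite -sA mem_nth.
    by move=> /set_mem[/andP[]].
  rewrite -[leRHS](nth_index (b + 2 * pi) bs).
  by rewrite (lt_sorted_leq_nth _ ss) ?inE ?index_mem.
have aln : nth (b + 2 * pi) s n = b + 2 * pi by rewrite nth_default ?sz.
have alA p : (p < n)%N -> A (nth (b + 2 * pi) s p).
  by move=> pn; apply/set_mem; rewrite -sA mem_nth ?sz.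
exists (nth (b + 2 * pi) s); split; rewrite ?al0 ?aln //.
- move=> p q /andP[pq]; rewrite leq_eqVlt => /orP[/eqP qn|qn].
    rewrite qn aln; have [|/andP[]//] := alA p _.
    by rewrite -qn.
  by rewrite (lt_sorted_ltn_nth _ ss) ?inE ?sz// (ltn_trans pq qn).
- move=> p; rewrite leq_eqVlt => /orP[/eqP ->|/alA[]//].
  by rewrite aln circle_point2pi -xb.
- move=> t ht Lt; have : t \in s by rewrite sA; exact/mem_set.
  move=> ts; exists (index t s); first by rewrite -sz index_mem.
  by rewrite nth_index.
Qed.

Lemma segment_of (al : nat -> R) m t : al 0%N <= t < al m ->
  exists2 p, (p < m)%N & al p <= t < al p.+1.
Proof.
elim: m => [|m IH] /andP[h1 h2]; first by have := le_lt_trans h1 h2; rewrite ltxx.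
have [tm|tm] := ltP t (al m); last by exists m; rewrite ?tm.
have [|p pm hp] := IH; first by rewrite h1.
by exists p => //; exact: ltnW.
Qed.

(** An open segment between consecutive limit angles contains no limit point, so [Z] is locally
    isolated there; its ends are two-sided limits, so [Z] has no first or last element in it. Hence
    [Z] meets it in a copy of the integers. *)
Theorem circle_model : exists phi : 'I_n * int -> R * R,
  [/\ injective phi, forall u, Z (phi u), forall z, Z z -> exists u, phi u = z
    & forall u v w, cyc3 (phi u) (phi v) (phi w) <-> vcyc u v w].
Proof.
have [al [aln ali alL alA]] := limit_angles.
have p0 := @pi_gt0 R.
have al_le p q : (p <= q <= n)%N -> al p <= al q.
  move=> /andP[]; rewrite leq_eqVlt => /orP[/eqP ->//|pq qn].
  by apply/ltW/ali/andP.
have enum (p : 'I_n) : exists f : int -> R,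
    [/\ forall i, Z (circle_point (f i)) /\ al p < f i < al p.+1,
      {homo f : i j / i < j} &
      forall s, Z (circle_point s) -> al p < s < al p.+1 -> exists i, f i = s].
  have pn := ltn_ord p.
  have [||||| f [Sf fm fs]] := @discrete_enum R
    [set s | Z (circle_point s) /\ al p < s < al p.+1] (al p) (al p.+1).
  - by apply: ali; rewrite ltnSn.
  - by move=> s [].
  - move=> c hc; have [|e e0 he] := @angle_isolated c.
      move=> /alA[|q qn cq].
        have a0p : al 0%N <= al p by apply: al_le; rewrite leq0n ltnW.
        have apn : al p.+1 <= al n by apply: al_le; rewrite pn leqnn.
        by lra.
      move: hc; rewrite cq => /andP[h1 h2].
      have [qp|pq] := leqP q p.
        by move: h1; rewrite ltNge al_le// qp ltnW.
      by move: h2; rewrite ltNge al_le// pq ltnW.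
    by exists e => // s [Zs _]; exact: he.
  - move=> c /andP[h1 h2]; have [|s Zs hs] := @limit_point_down (al p.+1) (al p.+1 - c) (alL _ pn).
      by rewrite subr_gt0.
    by exists s; [split=> //; lra|lra].
  - move=> c /andP[h1 h2]; have [|s Zs hs] := @limit_point_up (al p) (c - al p) (alL _ (ltnW pn)).
      by rewrite subr_gt0.
    by exists s; [split=> //; lra|lra].
  by exists f; split=> // s Zs hs; apply: fs.
have [F HF] := choice enum.
have Fr u : al 0%N <= F u.1 u.2 < al 0%N + 2 * pi.
  have [/(_ u.2)[_ hs] _ _] := HF u.1; have pn := ltn_ord u.1.
  have a0p : al 0%N <= al u.1 by apply: al_le; rewrite leq0n ltnW.
  have apn : al u.1.+1 <= al n by apply: al_le; rewrite pn leqnn.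
  by rewrite -aln; lra.
have Flt u v : vlt u v -> F u.1 u.2 < F v.1 v.2.
  case: u v => [p i] [q j] /orP[/= pq|/andP[/eqP/= -> ij]]; last first.
    by have [_ + _] := HF q; apply.
  have [/(_ i)[_ /andP[_ h1]] _ _] := HF p; have [/(_ j)[_ /andP[h2 _]] _ _] := HF q.
  apply: lt_trans h1 (le_lt_trans _ h2); apply: al_le.
  by rewrite pq ltnW.
have FltE u v : (F u.1 u.2 < F v.1 v.2) = vlt u v.
  apply/idP/idP; last exact: Flt.
  by case: (vlt_total u v) => [//|->|/Flt vu uv]; [rewrite ltxx|have := lt_trans vu uv; rewrite ltxx].
exists (fun u => circle_point (F u.1 u.2)); split.
- move=> u v /(circle_point_inj (Fr u) (Fr v)) uv.
  by case: (vlt_total u v) => // /Flt; rewrite uv ltxx.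
- by move=> u; have [/(_ u.2)[]] := HF u.1.
- move=> z Zz; have [|t ht zt] := circle_angle_from (al 0%N) (x := z).
    by have [[/(_ _ Zz)]] := hZ.
  rewrite -aln in ht; have [p pn hp] := segment_of ht.
  have [_ _ /(_ t)] := HF (Ordinal pn); rewrite -zt/= => /(_ Zz)[|i it].
    move: hp; rewrite le_eqVlt => /andP[/orP[/eqP pt|->//] _].
    by have [_] := alL _ (ltnW pn); rewrite pt -zt.
  by exists (Ordinal pn, i); rewrite zt /= it.
- move=> u v w; rewrite (cyc3_circle_point (Fr u) (Fr v) (Fr w)) !FltE.
  by [].
Qed.

End CircleModel.

(** * Crossing arcs *)

(* [lia] does not see through the values of ordinals. *)
Ltac vlia :=
  repeat match goal with
  | H : context [nat_of_ord ?p] |- _ =>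
      let a := fresh in set (a := nat_of_ord p) in *; clearbody a
  | |- context [nat_of_ord ?p] =>
      let a := fresh in set (a := nat_of_ord p) in *; clearbody a
  end; lia.

Section Arcs.
Variable n : nat.
Implicit Types (u v w a b c d : 'I_n * int) (k : int) (p q : 'I_n).

Definition vsh k u : 'I_n * int := (u.1, u.2 + k).

Definition varc u v := [&& v != vsh (-1) u, v != u & v != vsh 1 u].

Definition vcyc4 u1 u2 u3 u4 :=
  [&& vcyc u1 u2 u3, vcyc u2 u3 u4, vcyc u3 u4 u1 & vcyc u4 u1 u2].

Definition vcross u v c d := vcyc4 u c v d || vcyc4 u d v c.

Definition vchain u1 u2 u3 u4 := [&& vlt u1 u2, vlt u2 u3 & vlt u3 u4].

Lemma vlt_irr u : vlt u u = false.
Proof. by rewrite /vlt ltnn eqxx ltxx. Qed.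

Lemma vlt_trans v u w : vlt u v -> vlt v w -> vlt u w.
Proof.
case: u v w => [p i] [q j] [r k]; rewrite /vlt -!val_eqE/=; vlia.
Qed.

Lemma vltE (p q : 'I_n) (i j : int) :
  vlt (p, i) (q, j) = (p < q)%N || (p == q :> nat) && (i < j).
Proof. by []. Qed.

(* Any finite set of vertices embeds in the ordered set of natural numbers, so
   statements on the relative position of a few vertices reduce to linear
   arithmetic. *)
Lemma vrank (s : seq ('I_n * int)) : exists r : 'I_n * int -> nat,
  (forall u v, u \in s -> v \in s -> vlt u v = (r u < r v)%N) /\
  (forall u v, u \in s -> v \in s -> (u == v) = (r u == r v)).
Proof.
pose r u := count (fun w => vlt w u) s.
have lt u v : u \in s -> vlt u v -> (r u < r v)%N.
  move=> us uv; rewrite {}/r; have sub w : vlt w u -> vlt w v by move=> /vlt_trans; exact.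
  elim: s us => //= w s IH; rewrite inE => /orP[/eqP <-|/IH h].
    rewrite uv vlt_irr add0n add1n ltnS; exact: sub_count.
  by rewrite -addnS leq_add//; case: (vlt w u) (sub w) => // ->.
have ltE u v : u \in s -> v \in s -> vlt u v = (r u < r v)%N.
  move=> us vs; apply/idP/idP; first exact: lt.
  by case: (vlt_total u v) => [//|->|/(lt _ _ vs)]; lia.
exists r; split=> // u v us vs; apply/eqP/eqP => [->//|ruv].
by case: (vlt_total u v) => // /[dup]; rewrite {1}ltE// => + _; rewrite ruv ltnn.
Qed.

(** Each of the two cyclic orders becomes one of four linear orders, according to the gap in which
    the circle is cut. *)
Lemma vcrossE u v c d : vcross u v c d =
  [|| vchain u c v d, vchain u d v c, vchain v c u d, vchain v d u c,
      vchain c u d v, vchain c v d u, vchain d u c v | vchain d v c u].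
Proof.
have [r [lt _]] := vrank [:: u; v; c; d].
rewrite /vcross /vcyc4 /vcyc /vchain !lt ?inE ?eqxx ?orbT//; lia.
Qed.

Lemma vcross_sym u v c d : vcross u v c d = vcross c d u v.
Proof. by rewrite !vcrossE; apply/idP/idP; do ![case/orP]; move->; rewrite ?orbT. Qed.

Lemma vcrossCl u v c d : vcross u v c d = vcross v u c d.
Proof. by rewrite !vcrossE; apply/idP/idP; do ![case/orP]; move->; rewrite ?orbT. Qed.

Lemma vcrossCr u v c d : vcross u v c d = vcross u v d c.
Proof. by rewrite vcross_sym vcrossCl vcross_sym. Qed.

Lemma vcross_chain u v c d : vchain u c v d -> vcross u v c d.
Proof. by rewrite vcrossE => ->. Qed.

Lemma vcrossP u v c d : vcross u v c d ->
  [\/ vchain u c v d \/ vchain u d v c, vchain v c u d \/ vchain v d u c,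
      vchain c u d v \/ vchain c v d u | vchain d u c v \/ vchain d v c u].
Proof.
rewrite vcrossE; do ![case/orP]; move=> ->;
  do [by constructor 1; auto | by constructor 2; auto
     |by constructor 3; auto | by constructor 4; auto].
Qed.

Definition vbtw u v c := vlt u c && vlt c v || vlt v c && vlt c u.

(** Crossing only depends on the sides of [{u, v}] on which [c] and [d] lie, and the linear interval
    between [u] and [v] is one of these sides wherever the circle is cut. *)
Lemma vcross_btw u v c d : vcross u v c d =
  [&& c != u, c != v, d != u, d != v & vbtw u v c (+) vbtw u v d].
Proof.
have [r [lt eq]] := vrank [:: u; v; c; d].
rewrite vcrossE /vchain /vbtw !lt ?eq ?inE ?eqxx ?orbT//; lia.
Qed.

(** The side [{u, u'}] and the crossing diagonals bound a triangle whose third corner is not a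
    vertex; an arc that enters it through the side leaves through a diagonal. *)
Lemma vcross_ptolemy u v u' v' c d : vcross u v u' v' -> vcross u u' c d ->
  vcross u v c d || vcross u' v' c d.
Proof.
have [r [lt eq]] := vrank [:: u; v; u'; v'; c; d].
move=> /vcrossP H1 /vcrossP H2; move: H1 H2.
rewrite !vcross_btw /vbtw /vchain !lt ?eq ?inE ?eqxx ?orbT// {lt eq}.
by case=> -[] /and3P[h1 h2 h3]; case=> -[] /and3P[h4 h5 h6]; lia.
Qed.

Lemma vsh0 u : vsh 0 u = u.
Proof. by case: u => p i; rewrite /vsh addr0. Qed.

Lemma vshD k l u : vsh k (vsh l u) = vsh (l + k) u.
Proof. by rewrite /vsh/= addrA. Qed.

Lemma vlt_vsh k u v : vlt (vsh k u) (vsh k v) = vlt u v.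
Proof. by rewrite /vlt/= ltrD2r. Qed.

Lemma vcross_vsh k u v c d :
  vcross (vsh k u) (vsh k v) (vsh k c) (vsh k d) = vcross u v c d.
Proof. by rewrite !vcrossE /vchain !vlt_vsh. Qed.

Lemma varcE p q (i j : int) :
  varc (p, i) (q, j) = (p != q :> nat) || (i + 1 < j) || (j + 1 < i).
Proof. by rewrite /varc /vsh/= !xpair_eqE -!val_eqE/=; vlia. Qed.

Lemma varcC u v : varc u v = varc v u.
Proof. by case: u v => p i [q j]; rewrite !varcE; vlia. Qed.

Lemma varc_vsh k u v : varc (vsh k u) (vsh k v) = varc u v.
Proof. by case: u v => p i [q j]; rewrite /vsh/= !varcE; vlia. Qed.

Lemma vcross_down u v : varc u v -> vcross u v (vsh (-1) u) (vsh (-1) v).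
Proof.
case: u v => p i [q j]; rewrite varcE vcrossE /vchain /vsh/= !vltE; vlia.
Qed.

Lemma vcross_arc u v c d : vcross u v c d -> varc u v.
Proof.
case: u v c d => p i [q j] [r k] [s l].
move=> /vcrossP; rewrite varcE /vchain !vltE.
by case=> -[] /and3P[h1 h2 h3]; vlia.
Qed.

End Arcs.

(** * Non-crossing partitions *)

Section SameBlock.
Variable n : nat.
Implicit Types (P : {set {set 'I_n}}) (p q : 'I_n).

Definition same_block P p q := [exists B in P, (p \in B) && (q \in B)].

Lemma same_blockC P p q : same_block P p q = same_block P q p.
Proof. by apply: eq_existsb => B; rewrite (andbC (p \in B)). Qed.

Lemma same_block_pblock P p q : finset.partition P [set: 'I_n]%SET ->
  same_block P p q = (q \in finset.pblock P p).
Proof.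
move=> partP; have /and3P[_ tI _] := partP.
apply/existsP/idP => [[B /and3P[BP pB qB]]|qp].
  by rewrite (finset.def_pblock tI BP pB).
exists (finset.pblock P p).
have cp : p \in finset.cover P by rewrite (finset.cover_partition partP) inE.
by rewrite finset.pblock_mem// finset.mem_pblock cp.
Qed.

Lemma noncrossing_rel (r : rel 'I_n) : equivalence_rel r ->
  (forall i k j l : 'I_n, (i < k)%N -> (k < j)%N -> (j < l)%N ->
    r i j -> r k l -> r i k) ->
  exists2 P, noncrossing_partition P & same_block P =2 r.
Proof.
move=> eqr nc; pose P := equivalence_partition r [set: 'I_n]%SET.
have eqr' : {in [set: 'I_n]%SET & &, equivalence_rel r} by move=> p q s _ _ _.
have partP : finset.partition P [set: 'I_n]%SET by exact: equivalence_partitionP.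
have sbP : same_block P =2 r.
  by move=> p q; rewrite same_block_pblock// finset.pblock_equivalence_partition ?inE.
exists P => //; split=> // i k j l B B' /andP[/andP[ik kj] jl] BP BP' iB jB kB' lB'.
have sb p q (D : {set 'I_n}) : D \in P -> p \in D -> q \in D -> r p q.
  by move=> DP pD qD; rewrite -sbP; apply/existsP; exists D; rewrite DP pD.
have := nc _ _ _ _ ik kj jl (sb _ _ _ BP iB jB) (sb _ _ _ BP' kB' lB').
rewrite -sbP => /existsP[D /and3P[DP iD kD]]; have /and3P[_ tI _] := partP.
rewrite -(finset.def_pblock tI BP iB) (finset.def_pblock tI DP iD).
by rewrite -(finset.def_pblock tI DP kD) (finset.def_pblock tI BP' kB').
Qed.

Lemma same_block_refl P p : noncrossing_partition P -> same_block P p p.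
Proof.
move=> [partP _].
by rewrite same_block_pblock// finset.mem_pblock (finset.cover_partition partP) inE.
Qed.

Lemma same_block_trans P p q r : noncrossing_partition P ->
  same_block P p q -> same_block P q r -> same_block P p r.
Proof.
move=> [/and3P[_ tI _] _].
move=> /existsP[B /and3P[BP pB qB]] /existsP[D /and3P[DP qD rD]].
apply/existsP; exists B; rewrite BP pB /=.
by rewrite -(finset.def_pblock tI BP qB) (finset.def_pblock tI DP qD).
Qed.

Lemma same_block_noncrossing P (i k j l : 'I_n) : noncrossing_partition P ->
  (i < k)%N -> (k < j)%N -> (j < l)%N ->
  same_block P i j -> same_block P k l -> same_block P i k.
Proof.
move=> [_ nc] ik kj jl /existsP[B /and3P[BP iB jB]] /existsP[D /and3P[DP kD lD]].
have e : B = D by apply: (nc i k j l) => //; rewrite ik kj.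
by apply/existsP; exists B; rewrite BP iB e kD.
Qed.

Lemma refinesP P P' : noncrossing_partition P -> noncrossing_partition P' ->
  refines P P' <-> forall p q, same_block P p q -> same_block P' p q.
Proof.
move=> [/and3P[_ _ P0] _] [partP' _]; split=> [ref p q|sub B BP].
  move=> /existsP[B /and3P[BP pB qB]]; have [B' BP' /fintype.subsetP BB'] := ref _ BP.
  by apply/existsP; exists B'; rewrite BP' !BB'.
have [p pB] : exists p, p \in B.
  by apply/set0Pn; apply: contraNneq P0 => <-.
have cp : p \in finset.cover P' by rewrite (finset.cover_partition partP') inE.
exists (finset.pblock P' p); first exact: finset.pblock_mem.
apply/fintype.subsetP => q qB; rewrite -same_block_pblock//; apply: sub.
by apply/existsP; exists B; rewrite BP pB.
Qed.

Lemma refines_anti P P' : noncrossing_partition P -> noncrossing_partition P' ->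
  refines P P' -> refines P' P -> P = P'.
Proof.
have sub (D D' : {set {set 'I_n}}) : noncrossing_partition D ->
    refines D D' -> refines D' D -> D \subset D'.
  move=> [/and3P[_ tI D0] _] r1 r2; apply/fintype.subsetP => B BD.
  have [B' BD' BB'] := r1 _ BD; have [B2 B2D BB2] := r2 _ BD'.
  have [p pB] : exists p, p \in B by apply/set0Pn; apply: contraNneq D0 => <-.
  have e : B = B2.
    rewrite -(finset.def_pblock tI BD pB); apply: finset.def_pblock => //.
    by apply: (fintype.subsetP BB2); apply: (fintype.subsetP BB').
  suff -> : B = B' by [].
  by apply/eqP; rewrite finset.eqEsubset BB' e.
move=> nP nP' r1 r2; apply/eqP; rewrite finset.eqEsubset.
by apply/andP; split; exact: sub.
Qed.

(** An intersection of non-crossing equivalence relations is again non-crossing. Infima of arbitrary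
    families give joins as infima of upper bounds, whereas the equivalence relation generated by two
    non-crossing ones may cross. *)
Lemma noncrossing_inf (S : set {set {set 'I_n}}) :
  exists m, [/\ noncrossing_partition m,
    forall P, noncrossing_partition P -> S P -> refines m P &
    forall Q, noncrossing_partition Q ->
      (forall P, noncrossing_partition P -> S P -> refines Q P) -> refines Q m].
Proof.
pose r p q := `[< forall P, noncrossing_partition P -> S P -> same_block P p q >].
have [||m nm mr] := @noncrossing_rel r.
- move=> p q s; split; first by apply/asboolP => P nP _; exact: same_block_refl.
  move=> /asboolP pq; apply/asboolP/asboolP => h P nP SP; apply: same_block_trans (h P nP SP) => //.
    by rewrite same_blockC; exact: pq.
  exact: pq.
- move=> i k j l ik kj jl /asboolP ij /asboolP kl; apply/asboolP => P nP SP.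
  exact: same_block_noncrossing ik kj jl (ij P nP SP) (kl P nP SP).
exists m; split=> // [P nP SP|Q nQ QS].
  by apply/refinesP => // p q; rewrite mr => /asboolP; apply.
apply/refinesP => // p q pq; rewrite mr; apply/asboolP => P nP SP.
by have /refinesP := QS P nP SP; apply.
Qed.

Lemma noncrossing_lattice :
  is_lattice [set P : {set {set 'I_n}} | noncrossing_partition P] (@refines n).
Proof.
split.
- by move=> P nP; apply/refinesP.
- by move=> P P'; exact: refines_anti.
- move=> P P' P'' nP nP' nP'' /refinesP h /refinesP h'; apply/refinesP => // p q pq.
  by apply: h' => //; apply: h.
- move=> P P' nP nP'; have [m [nm mlb mgl]] := noncrossing_inf [set P; P'].
  exists m; split=> //; first by apply: mlb => //; left.
    by apply: mlb => //; right.
  by move=> Q nQ QP QP'; apply: mgl => // S nS [] ->.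
- move=> P P' nP nP'.
  have [m [nm mlb mgl]] := noncrossing_inf [set Q | refines P Q /\ refines P' Q].
  exists m; split=> //; [by apply: mgl => // Q _ []|by apply: mgl => // Q _ []|].
  by move=> Q nQ PQ P'Q; exact: mlb.
Qed.

End SameBlock.

(** * Aisles as sets of arcs *)

Section Classification.
Variable n : nat.
Implicit Types (u v w a b c d : 'I_n * int) (k : int) (p q : 'I_n).

Definition std_aisle (P : {set {set 'I_n}}) (x : 'I_n -> int) u v :=
  [&& varc u v, same_block P u.1 v.1, u.2 <= x u.1 & v.2 <= x v.1].

Definition crossed (X : 'I_n * int -> 'I_n * int -> Prop) c d :=
  exists a b, X a b /\ vcross a b c d.

(** The trace on arcs of a non-degenerate t-structure. The coaisle consists, up to a shift, of the
    arcs not crossed by [X], so [aa_nc] says that the aisle is the left orthogonal of the coaisle,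
    and [aa_conondeg] that no arc has all its suspensions in the coaisle. *)
Record arc_aisle (X : 'I_n * int -> 'I_n * int -> Prop) : Prop := ArcAisle {
  aa_arc : forall u v, X u v -> varc u v;
  aa_sym : forall u v, X u v -> X v u;
  aa_nc : forall u v, varc u v ->
    (forall c d, varc c d -> vcross u v c d -> crossed X c d) -> X u v;
  aa_susp : forall u v, X u v -> X (vsh (-1) u) (vsh (-1) v);
  aa_nondeg : forall u v, varc u v -> exists k, ~ X (vsh k u) (vsh k v);
  aa_conondeg : forall u v, varc u v -> exists k, crossed X (vsh k u) (vsh k v) }.

Variable X : 'I_n * int -> 'I_n * int -> Prop.
Hypothesis HX : arc_aisle X.

Lemma aa_ptolemy u v u' v' :
  X u v -> X u' v' -> vcross u v u' v' -> varc u u' -> X u u'.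
Proof.
move=> Xuv Xuv' cr ar; apply: aa_nc => // c d acd cr'.
have /orP[h|h] := vcross_ptolemy cr cr'.
  by exists u, v.
by exists u', v'.
Qed.

(** An arc crosses its own suspension, so the Ptolemy property lowers one endpoint while keeping the
    other. *)
Lemma aa_move u v : X u v -> varc (vsh (-1) u) v -> X (vsh (-1) u) v.
Proof.
move=> Xuv ar; have cr := vcross_down (aa_arc HX Xuv).
apply: (@aa_ptolemy _ (vsh (-1) v) _ u _ (aa_sym HX Xuv)) => //.
  exact: aa_susp.
by rewrite vcross_sym vcrossCl.
Qed.

Lemma aa_down p (i i' : int) w : X (p, i) w -> i' <= i ->
  (forall k, i' <= k <= i -> varc (p, k) w) -> X (p, i') w.
Proof.
move=> Xw ii' ar.
suff down m : m%:Z <= i - i' -> X (p, i - m%:Z) w.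
  have -> : i' = i - (`|(i - i')%R|%N)%:Z by lia.
  by apply: down; lia.
elim: m => [|m IH] le; first by rewrite subr0.
have -> : (p, i - m.+1%:Z) = vsh (-1) (p, i - m%:Z) by rewrite /vsh/=; congr (_, _); lia.
apply: aa_move; first by apply: IH; lia.
by rewrite /vsh/=; apply: ar; lia.
Qed.

(* The endpoint [(p, i)] can be moved down along its segment until the arc
   crosses [{(p, m), d}]. *)
Lemma aa_crossed_below p (i m : int) w d :
  X (p, i) w -> m < i -> varc (p, m) d -> crossed X (p, m) d.
Proof.
case: w d => q j [r l] Xw mi ar.
have [qp|qp] := eqVneq (q : nat) p; last first.
  have X' k j' : k <= i -> j' <= j -> X (p, k) (q, j').
    move=> ki jj; apply: aa_sym => //; apply: (@aa_down q j) => //.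
      apply: aa_sym => //; apply: (@aa_down p i) => // z _.
      by rewrite varcE; vlia.
    by move=> z _; rewrite varcE; vlia.
  have [rp|rp] := eqVneq (r : nat) p.
    have [lm|lm] := ltP l m.
      exists (p, m - 1), (q, j); split; first by apply: X'; lia.
      move: ar; rewrite varcE vcross_btw /vbtw !vltE !xpair_eqE -!val_eqE/=; vlia.
    exists (p, m + 1), (q, j); split; first by apply: X'; lia.
    move: ar; rewrite varcE vcross_btw /vbtw !vltE !xpair_eqE -!val_eqE/=; vlia.
  (* [j'] keeps the new arc from ending at [(r, l)]. The points [m - 1] and [m + 1] lie on opposite
     sides of the arc to be crossed, so one of them is opposite to [(q, j')]. *)
  pose j' := if l == j then j - 1 else j.
  have X1 := X' (m - 1) j'; have X2 := X' (m + 1) j'.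
  have [c1|c1] := boolP (vcross (p, m - 1) (q, j') (p, m) (r, l)).
    by exists (p, m - 1), (q, j'); split=> //; apply: X1; [lia|rewrite /j'; case: ifP; lia].
  exists (p, m + 1), (q, j'); split; first by apply: X2; [lia|rewrite /j'; case: ifP; lia].
  move: c1; rewrite !vcross_btw /vbtw !vltE !xpair_eqE -!val_eqE/= /j'.
  case: ifP; vlia.
have qpE := ord_inj qp.
subst q; wlog ji : i j Xw mi / j < i.
  move=> H; have := aa_arc HX Xw; rewrite varcE => a1.
  have [ji|ij] := ltP j i; first exact: (H i j).
  by apply: (H j i); [exact: aa_sym|lia|vlia].
have X' i' j' : i' <= i -> j' <= j -> j' + 1 < i' -> X (p, i') (p, j').
  have a1 := aa_arc HX Xw; rewrite varcE in a1.
  move=> ii jj ij; apply: (@aa_down p i) => //; last by move=> z hz; rewrite varcE; vlia.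
  apply: aa_sym => //; apply: (@aa_down p j) => //; last by move=> z hz; rewrite varcE; vlia.
  exact: aa_sym.
have [rp|rp] := eqVneq (r : nat) p.
  (* The new arc straddles the lower end of the arc to be crossed; the upper end is at least
     [lo + 2] and stays outside. *)
  pose lo := Num.min m l.
  exists (p, lo + 1), (p, Num.min j lo - 1); split.
    apply: X'; rewrite /lo; lia.
  move: ar; rewrite varcE vcross_btw /vbtw !vltE !xpair_eqE -!val_eqE/= /lo; vlia.
exists (p, m + 1), (p, Num.min j m - 1); split; first by apply: X'; lia.
rewrite vcross_btw /vbtw !vltE !xpair_eqE -!val_eqE/=; vlia.
Qed.

(** An arc crossing [{(p, i1), (p, i2)}] ends at some [(p, m)] strictly between, hence below [i],
    and is therefore crossed by [X]; [aa_nc] applies. *)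
Lemma aa_same_segment p (i i1 i2 : int) w : X (p, i) w -> i1 <= i -> i2 <= i ->
  varc (p, i1) (p, i2) -> X (p, i1) (p, i2).
Proof.
move=> Xw; wlog i12 : i1 i2 / i1 < i2.
  move=> H h1 h2 ar; have [lt|ge] := ltP i1 i2; first exact: H.
  apply: aa_sym => //; apply: H => //; last by rewrite varcC.
  by move: ar; rewrite varcE; vlia.
move=> h1 h2 ar; apply: aa_nc => // c d acd cr.
suff: exists2 m, i1 < m < i2 & c = (p, m) \/ d = (p, m).
  move=> [m hm [cm|dm]].
    by rewrite cm; apply: (@aa_crossed_below p i m w) => //; [lia|rewrite -cm].
  have [a [b [Xab cr']]] : crossed X d c.
    by rewrite dm; apply: (@aa_crossed_below p i m w) => //; [lia|rewrite -dm varcC].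
  by exists a, b; split=> //; rewrite vcrossCr.
case: c d {acd} cr => [q j] [r l] /vcrossP; rewrite /vchain !vltE.
have E (s : 'I_n) : (s : nat) = p -> s = p by exact: ord_inj.
case=> -[] /and3P[/= g1 g2 g3]; first [exfalso; vlia
  | exists j; [vlia|left; congr (_, _); apply: E; vlia]
  | exists l; [vlia|right; congr (_, _); apply: E; vlia]].
Qed.

(** The only vertex between [(p, k)] and [(p, k + 2)] is [(p, k + 1)], so an arc of [X] crossing
    this short arc ends there. *)
Lemma aa_segment_nonempty p : exists i w, X (p, i) w.
Proof.
have [|k [a [b [Xab cr]]]] := aa_conondeg HX (u := (p, 0)) (v := (p, 2)).
  by rewrite varcE; lia.
suff [] : a = (p, k + 1) \/ b = (p, k + 1).
  by move=> ak; exists (k + 1), b; rewrite -ak.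
  by move=> bk; exists (k + 1), a; rewrite -bk; exact: aa_sym.
case: a b cr {Xab} => [q j] [r l] /vcrossP; rewrite /vsh/= /vchain !vltE.
have E (s : 'I_n) : (s : nat) = p -> s = p by exact: ord_inj.
case=> -[] /and3P[/= g1 g2 g3]; first [exfalso; vlia
  | left; congr (_, _); [apply: E; vlia|vlia]
  | right; congr (_, _); [apply: E; vlia|vlia]].
Qed.

(** An endpoint above a short arc of the segment would put that arc in [X], and non-degeneracy
    excludes one of them. *)
Lemma aa_segment_bounded p : exists N : int, forall i w, X (p, i) w -> i <= N.
Proof.
apply: contrapT => nb.
have [|k Xk] := aa_nondeg HX (u := (p, 0)) (v := (p, 2)); first by rewrite varcE; lia.
apply: Xk; rewrite /vsh/=; apply: contrapT => nX; apply: nb; exists (2 + k) => i w Xw.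
have [//|lt] := leP i (2 + k); exfalso; apply: nX.
by apply: (aa_same_segment Xw); rewrite ?varcE; lia.
Qed.

Lemma int_max (Q : int -> Prop) (N i0 : int) : Q i0 -> (forall i, Q i -> i <= N) ->
  exists i, Q i /\ forall j, Q j -> j <= i.
Proof.
move=> Q0 QN.
have [m Qm mmin] : exists2 m : nat, Q (N - m%:Z) & forall l : nat, Q (N - l%:Z) -> (m <= l)%N.
  have ex : exists m : nat, `[< Q (N - m%:Z) >].
    exists `|(N - i0)%R|%N; apply/asboolP.
    by have -> : N - (`|(N - i0)%R|%N)%:Z = i0 by have := QN _ Q0; lia.
  exists (ex_minn ex); case: ex_minnP => m /asboolP //.
  by move=> _ h l Ql; apply: h; apply/asboolP.
exists (N - m%:Z); split=> // j Qj; have := QN _ Qj => jN.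
have := mmin `|(N - j)%R|%N; have -> : N - (`|(N - j)%R|%N)%:Z = j by lia.
by move=> /(_ Qj); lia.
Qed.

Lemma aa_segment_max p : exists x : int,
  (exists w, X (p, x) w) /\ forall i w, X (p, i) w -> i <= x.
Proof.
have [N HN] := aa_segment_bounded p; have [i [w Xw]] := aa_segment_nonempty p.
have [||x [Qx max]] := @int_max (fun i => exists w, X (p, i) w) N i.
- by exists w.
- by move=> j [v /HN].
by exists x; split=> // j v Xv; apply: max; exists v.
Qed.

(** Raising uses the Ptolemy property with [{(p, i'), (p, i - 1)}], an arc within the segment that
    is in [X] because [i'] is below an endpoint of [X]; it straddles [(p, i)]. *)
Lemma aa_raise p q (i i' i0 : int) j w0 : p != q ->
  X (p, i) (q, j) -> X (p, i0) w0 -> i' <= i0 -> X (p, i') (q, j).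
Proof.
move=> pq Xij Xw ii; have pq' : p != q :> nat by rewrite val_eqE.
have [le|lt] := leP i' i.
  by apply: (aa_down Xij le) => k _; rewrite varcE pq'.
have X1 : X (p, i') (p, i - 1).
  by apply: (aa_same_segment Xw) => //; rewrite ?varcE; vlia.
apply: aa_sym => //.
apply: (aa_ptolemy (aa_sym HX Xij) X1); last by rewrite varcE eq_sym pq'.
rewrite vcross_btw /vbtw !vltE !xpair_eqE -!val_eqE/=; vlia.
Qed.

Definition linked p q : bool := (p == q) || `[< exists i j, X (p, i) (q, j) >].

Lemma aa_arcP (x : 'I_n -> int) :
  (forall p, (exists w, X (p, x p) w) /\ forall i w, X (p, i) w -> i <= x p) ->
  forall u v, X u v <-> [&& varc u v, linked u.1 v.1, u.2 <= x u.1 & v.2 <= x v.1].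
Proof.
move=> Hx [p i] [q j]; split=> [Xuv|/and4P[/= ar lk ip jq]].
  rewrite (aa_arc HX Xuv) /= ((Hx p).2 _ _ Xuv) ((Hx q).2 _ _ (aa_sym HX Xuv)) !andbT.
  by rewrite /linked; apply/orP; right; apply/asboolP; exists i, j.
have [[w Xw] _] := Hx p; have [[w' Xw'] _] := Hx q.
have [pq|pq] := eqVneq p q.
  by subst q; apply: (aa_same_segment Xw).
move: lk; rewrite /linked (negPf pq)/= => /asboolP[i1 [j1 X1]].
apply: (aa_raise pq _ Xw ip); apply: aa_sym => //.
by apply: (aa_raise _ (aa_sym HX X1) Xw' jq); rewrite eq_sym.
Qed.

Lemma linked_sym p q : linked p q = linked q p.
Proof.
rewrite /linked eq_sym; congr (_ || _); apply/asboolP/asboolP => -[i [j Xij]];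
  by exists j, i; exact: aa_sym.
Qed.

Lemma linked_trans p q r : linked p q -> linked q r -> linked p r.
Proof.
have [x Hx] := choice aa_segment_max.
have L := aa_arcP Hx.
rewrite {1}/linked; case: eqVneq => [->//|pq] /= Lpq.
have {}Lpq : linked p q by rewrite /linked Lpq orbT.
rewrite {1}/linked; case: eqVneq => [<-//|qr] /= Lqr.
have {}Lqr : linked q r by rewrite /linked Lqr orbT.
have [->|pr] := eqVneq p r; first by rewrite /linked eqxx.
have npq : p != q :> nat by rewrite val_eqE.
have nqr : q != r :> nat by rewrite val_eqE.
have npr : p != r :> nat by rewrite val_eqE.
have X1 k : k <= x q -> X (p, x p) (q, k).
  by move=> kq; apply/L; rewrite varcE npq Lpq /= lexx.
have X2 k : k <= x q -> X (r, x r) (q, k).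
  by move=> kq; apply: aa_sym => //; apply/L; rewrite varcE nqr Lqr /= lexx kq.
suff Xpr : X (p, x p) (r, x r).
  by rewrite /linked; apply/orP; right; apply/asboolP; exists (x p), (x r).
have arc_pr : varc (p, x p) (r, x r) by rewrite varcE npr.
(* Arcs from [p] and from [r] to the adjacent vertices [x q] and [x q - 1] of [q] cross for exactly
   one of the two ways to assign these ends. *)
have [c1|c1] := boolP (vcross (p, x p) (q, x q) (r, x r) (q, x q - 1)).
  by apply: (aa_ptolemy (X1 _ _) (X2 _ _) c1) => //; lia.
apply: (@aa_ptolemy _ (q, x q - 1) _ (q, x q)) => //; [apply: X1; lia|exact: X2|].
move: c1; rewrite !vcross_btw /vbtw !vltE !xpair_eqE -!val_eqE/=.
move: (x p) (x q) (x r) => i j k; vlia.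
Qed.

Theorem arc_aisle_classification : exists P x, noncrossing_partition P /\
  forall u v, X u v <-> std_aisle P x u v.
Proof.
have [x Hx] := choice aa_segment_max; have L := aa_arcP Hx.
have [||P ncP sbP] := @noncrossing_rel _ linked.
- move=> p q r; split=> [|pq]; first by rewrite /linked eqxx.
  apply/idP/idP; first by apply: linked_trans; rewrite linked_sym.
  exact: linked_trans.
- move=> i k j l ik kj jl lij lkl.
  have Xl p q : (p < q)%N -> linked p q -> X (p, x p) (q, x q).
    by move=> pq lpq; apply/L; rewrite /= lpq varcE !lexx; vlia.
  have X1 := Xl _ _ (ltn_trans ik kj) lij.
  have X2 := Xl _ _ (ltn_trans kj jl) lkl.
  have X3 : X (i, x i) (k, x k).
    apply: (aa_ptolemy X1 X2); last by rewrite varcE; vlia.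
    by apply: vcross_chain; rewrite /vchain !vltE ik kj jl.
  by rewrite /linked; apply/orP; right; apply/asboolP; exists (x i), (x k).
by exists P, x; split=> // u v; rewrite L /std_aisle sbP.
Qed.

End Classification.

(** * The set of arcs given by a partition and heights *)

Section StandardAisles.
Variables (n : nat) (P : {set {set 'I_n}}) (x : 'I_n -> int).
Hypothesis ncP : noncrossing_partition P.
Implicit Types (u v w a b c d : 'I_n * int) (k : int) (p q : 'I_n).

(** The interval is open at [lo] and closed at [hi] to match the chord from [(lo, x lo + 1)] to
    [(hi, x hi + 1)]: vertices of admissible height lie before its start in segment [lo], but before
    its end in segment [hi]. *)
Definition saturated (lo hi : nat) := forall p q, same_block P p q ->
  (lo < p <= hi)%N -> (lo < q <= hi)%N.

(* For [p < q], cut along the hull of the block of [q] if that block has no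
   element below [p], and along the gap of that block around [p] otherwise. *)
Lemma same_block_separation p q : ~~ same_block P p q ->
  exists lo hi : 'I_n, [/\ (lo < hi)%N, saturated lo hi &
    (lo < p <= hi)%N (+) (lo < q <= hi)%N].
Proof.
wlog pq : p q / (p < q)%N.
  move=> H npq; have [lt|gt|/ord_inj e] := ltngtP p q.
  - exact: H.
  - have [|lo [hi [h1 h2 h3]]] := H q p gt; first by rewrite same_blockC.
    by exists lo, hi; split=> //; rewrite addbC.
  - by move: npq; rewrite e (same_block_refl _ ncP).
move=> npq; pose B s := same_block P q s.
have sB s t : same_block P s t -> B s -> B t.
  by move=> st qs; exact: same_block_trans ncP qs st.
have sB' s t : B s -> B t -> same_block P s t.
  by move=> qs; apply: (same_block_trans ncP); rewrite same_blockC.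
have qB : B q by exact: same_block_refl.
have npB : ~~ B p by rewrite /B same_blockC.
have nc (i k j l : 'I_n) : B i -> B j -> ~~ B k -> (i < k)%N -> (k < j)%N -> (j < l)%N ->
    ~~ same_block P k l.
  move=> Bi Bj nk ik kj jl; apply: contra nk => kl; apply: (sB i) => //.
  exact: same_block_noncrossing ncP ik kj jl (sB' _ _ Bi Bj) kl.
have nc' (i k j l : 'I_n) : B i -> B j -> ~~ B k -> (l < i)%N -> (i < k)%N -> (k < j)%N ->
    ~~ same_block P k l.
  move=> Bi Bj nk li ik kj; apply: contra nk => kl; apply: (sB l) => //.
    by rewrite same_blockC.
  apply: (sB i) => //; rewrite same_blockC.
  by apply: same_block_noncrossing ncP li ik kj _ (sB' _ _ Bi Bj); rewrite same_blockC.
have [s /andP[Bs sp]|no] := pickP [pred s | B s && (s < p)%N].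
  case: (arg_maxnP (P := [pred s | B s && (s < p)%N]) (i0 := s) (fun s => s : nat)).
    by rewrite /= Bs sp.
  move=> r /andP[Br rp] rmax.
  case: (arg_minnP (P := [pred s | B s && (p < s)%N]) (i0 := q) (fun s => s : nat)).
    by rewrite /= qB pq.
  move=> r' /andP[Br' pr'] rmin.
  have gap (t : 'I_n) : (r < t < r')%N -> ~~ B t.
    move=> ht; apply/negP => Bt; have [tp|tp|/ord_inj tp] := ltngtP t p.
    - by have := rmax t; rewrite /= Bt tp => /(_ isT); lia.
    - by have := rmin t; rewrite /= Bt tp => /(_ isT); lia.
    - by move: npB; rewrite -tp Bt.
  have r'q : (r' <= q)%N by apply: rmin; rewrite /= qB pq.
  have hi_lt : (r'.-1 < n)%N by have := ltn_ord r'; lia.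
  exists r, (Ordinal hi_lt); split=> /=; [lia| |lia].
  move=> k l kl hk.
  have nk : ~~ B k by apply: gap; lia.
  have nl : ~~ B l by apply: contra nk; apply: sB; rewrite same_blockC.
  have [lr|lr] := leqP l r.
    have [e|lr'] := eqVneq (l : nat) r; first by move: nl; rewrite (ord_inj e) Br.
    have := nc' r k r' l Br Br' nk; rewrite kl /=; lia.
  have [r'l|r'l] := leqP r' l; last lia.
  have [e|lr'] := eqVneq (l : nat) r'; first by move: nl; rewrite (ord_inj e) Br'.
  have := nc r k r' l Br Br' nk; rewrite kl /=; lia.
case: (arg_maxnP (P := B) (i0 := q) (fun s => s : nat) qB) => M BM Mmax.
case: (arg_minnP (P := B) (i0 := q) (fun s => s : nat) qB) => m Bm mmin.
have pm : (p < m)%N.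
  have [//|mp|/ord_inj e] := ltngtP p m; last by move: npB; rewrite e Bm.
  by have := no m; rewrite /= Bm mp.
have lo_lt : (m.-1 < n)%N by have := ltn_ord m; lia.
have hq : (m <= q <= M)%N by apply/andP; split; [exact: mmin|exact: Mmax].
exists (Ordinal lo_lt), M; split=> /=; [lia| |lia].
move=> k l kl hk.
have [Bk|nk] := boolP (B k).
  by have Bl := sB _ _ kl Bk; have := mmin _ Bl; have := Mmax _ Bl => /= ? ?; lia.
have [e|km] := eqVneq (k : nat) m; first by move: nk; rewrite (ord_inj e) Bm.
have [e|kM] := eqVneq (k : nat) M; first by move: nk; rewrite (ord_inj e) BM.
have := nc m k M l Bm BM nk; have := nc' m k M l Bm BM nk; rewrite kl /=; lia.
Qed.

Lemma std_aisle_sym u v : std_aisle P x u v = std_aisle P x v u.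
Proof. by rewrite /std_aisle varcC same_blockC (andbC (u.2 <= _)). Qed.

(** The vertices strictly between the two ends are higher than [x p], and no arc of the aisle ends
    there. *)
Lemma upper_uncrossed p (i j : int) :
  x p <= i -> x p <= j -> ~ crossed (std_aisle P x) (p, i) (p, j).
Proof.
move=> pi pj [[q k] [[r l] [/and4P[/= _ _ kx lx]]]].
have E (s : 'I_n) m : m <= x s -> s = p :> nat -> m <= x p.
  by move=> ? /ord_inj <-.
move: (E q k kx) (E r l lx) => {}E E' /vcrossP; rewrite /vchain !vltE.
case=> -[] /and3P[h1 h2 h3]; move: E E'; vlia.
Qed.

Lemma cut_btw (lo hi : 'I_n) u : (lo < hi)%N -> u.2 <= x u.1 ->
  [/\ vbtw (lo, x lo + 1) (hi, x hi + 1) u = (lo < u.1 <= hi)%N,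
      u != (lo, x lo + 1) & u != (hi, x hi + 1)].
Proof.
case: u => q k lh /= kx.
have E (s : 'I_n) : q = s :> nat -> k <= x s by move=> /ord_inj <-.
move: (E lo) (E hi) => {E} e1 e2.
rewrite /vbtw !vltE !xpair_eqE -!val_eqE/=.
by move: (x lo) (x hi) e1 e2 => xl xh e1 e2; split; vlia.
Qed.

Lemma cut_cross u v (lo hi : 'I_n) : (lo < hi)%N -> u.2 <= x u.1 -> v.2 <= x v.1 ->
  vcross u v (lo, x lo + 1) (hi, x hi + 1) =
  (lo < u.1 <= hi)%N (+) (lo < v.1 <= hi)%N.
Proof.
move=> lh ux vx; have [e1 e2 e3] := cut_btw lh ux; have [e4 e5 e6] := cut_btw lh vx.
by rewrite vcross_sym vcross_btw e1 e2 e3 e4 e5 e6.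
Qed.

Lemma cut_uncrossed (lo hi : 'I_n) : (lo < hi)%N -> saturated lo hi ->
  ~ crossed (std_aisle P x) (lo, x lo + 1) (hi, x hi + 1).
Proof.
move=> lh sat [u [v [/and4P[_ uv ux vx]]]]; rewrite cut_cross//.
suff -> : (lo < u.1 <= hi)%N = (lo < v.1 <= hi)%N by rewrite addbb.
by apply/idP/idP; apply: sat; rewrite // same_blockC.
Qed.

(** By contraposition: an arc with too high an end crosses an uncrossed arc within that segment, and
    an arc joining two blocks crosses the chord separating them. *)
Lemma std_aisle_nc u v : varc u v ->
  (forall c d, varc c d -> vcross u v c d -> crossed (std_aisle P x) c d) ->
  std_aisle P x u v.
Proof.
have low p i w : varc (p, i) w ->
    (forall c d, varc c d -> vcross (p, i) w c d -> crossed (std_aisle P x) c d) ->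
    i <= x p.
  case: w => q j ar H; have [//|lt] := leP i (x p); exfalso.
  have no (a b : int) : x p <= a -> x p <= b -> varc (p, a) (p, b) ->
      ~~ vcross (p, i) (q, j) (p, a) (p, b).
    move=> ha hb arab; apply/negP => cr.
    exact: upper_uncrossed ha hb (H _ _ arab cr).
  (* The first arc encloses [i]. The second serves when [w] is its end [(p, x p)], and the third,
     enclosing [w] instead, when [w] lies between [x p] and [i]. *)
  have n1 := no (x p) (i + 1); have n2 := no (x p + 1) (i + 1).
  have n3 := no (x p) (j + 1).
  move: n1 n2 n3 ar; rewrite !vcross_btw /vbtw !varcE !vltE !xpair_eqE -!val_eqE/=.
  move: (x p) lt => xp lt {no H}; vlia.
move=> ar H; rewrite /std_aisle ar /=.
have ux : u.2 <= x u.1 by case: u ar H => p i ar H /=; exact: low ar H.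
have vx : v.2 <= x v.1.
  case: v ar H ux => q j; rewrite varcC => ar H ux /=; apply: (low _ _ _ ar).
  by move=> c d acd; rewrite vcrossCl; exact: H.
rewrite ux vx !andbT; apply: contrapT => /negP /same_block_separation[lo [hi [lh sat sep]]].
apply: (cut_uncrossed lh sat); apply: H; last by rewrite cut_cross.
by rewrite varcE; vlia.
Qed.

Lemma std_arc_aisle : arc_aisle (std_aisle P x).
Proof.
split.
- by move=> u v /and4P[].
- by move=> u v; rewrite std_aisle_sym.
- exact: std_aisle_nc.
- by move=> u v /and4P[ar sb ux vx]; rewrite /std_aisle varc_vsh ar sb /=; lia.
- move=> u v ar; exists (x u.1 - u.2 + 1); rewrite /std_aisle /= => /and4P[_ _ + _]; lia.
(* The shift brings [(p, i + k + 1)] down to height at most [x p]; the arc joining the two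
   neighbours of [(p, i + k)] then belongs to the aisle and crosses every arc ending at
   [(p, i + k)]. *)
- move=> [p i] [q j] ar; pose k := Num.min (x p - 1 - i) (x q - 1 - j).
  exists k, (p, i + k - 1), (p, i + k + 1).
  rewrite /std_aisle (same_block_refl _ ncP) varcE vcross_btw /vbtw /vsh !vltE !xpair_eqE -!val_eqE/=.
  have : k <= x p - 1 - i by rewrite /k; lia.
  by move: ar; rewrite varcE; move: k (x p) => k xp; split; vlia.
Qed.

End StandardAisles.

(** * Last admissible vertices before a given vertex *)

Section CyclicMaximum.
Variables (n : nat) (x : 'I_n -> int).
Implicit Types (u v w a b c d s t : 'I_n * int) (W : 'I_n * int -> Prop).

Lemma vlt_max W s : (forall u, W u -> u.2 <= x u.1) -> W s ->
  exists m, W m /\ forall t, W t -> ~~ vlt m t.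
Proof.
move=> Wx Ws; pose Q p := `[< exists i, W (p, i) >].
have Qs : Q s.1 by apply/asboolP; exists s.2; case: s Ws.
case: (arg_maxnP (fun p : 'I_n => p : nat) Qs) => p /asboolP[i Wi] pmax.
have [|j [Wj jmax]] := @int_max (fun i => W (p, i)) (x p) i Wi; first by move=> j /Wx.
exists (p, j); split=> // -[q k] Wq; rewrite vltE.
have qp : (q <= p)%N by apply: pmax; apply/asboolP; exists k.
have kj : q = p :> nat -> k <= j by move=> /ord_inj qp'; apply: jmax; rewrite -qp'.
by move: qp kj {Qs pmax}; vlia.
Qed.

(** Going from [b] round to [a], the vertices below [a] come after those above it. So the maximum is
    taken among the former if there are any, and among the latter otherwise. *)
Lemma vcyc_max W s a b : (forall u, W u -> u.2 <= x u.1) -> W s -> vcyc b s a ->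
  exists m, [/\ W m, vcyc b m a & forall t, W t -> ~~ vcyc m t a].
Proof.
move=> Wx Ws bsa.
have cyc_lt m t : vcyc b m a -> vcyc m t a -> [/\ vcyc b t a,
    vlt m a -> vlt t a /\ vlt m t & vlt a m -> vlt t a \/ vlt m t].
  have [r [lt _]] := vrank [:: b; m; a; t].
  rewrite /vcyc !lt ?inE ?eqxx ?orbT// => h1 h2.
  by split; [|move=> h3; split|move=> h3; apply/orP]; lia.
have cyc_total t : vcyc b t a -> ~~ vlt t a -> vlt a t.
  have [r [lt _]] := vrank [:: b; t; a].
  by rewrite /vcyc !lt ?inE ?eqxx ?orbT//; lia.
have [[t [Wt bta ta]]|no] := pselect (exists t, [/\ W t, vcyc b t a & vlt t a]).
  have [||m [[Wm bma ma] mmax]] := @vlt_max (fun t => [/\ W t, vcyc b t a & vlt t a]) t.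
  - by move=> u [/Wx].
  - by [].
  exists m; split=> // u Wu; apply/negP => mua.
  have [bua /(_ ma)[ua mu] _] := cyc_lt _ _ bma mua.
  by have := mmax u; rewrite mu => /(_ (And3 Wu bua ua)).
have [||m [[Wm bma] mmax]] := @vlt_max (fun t => W t /\ vcyc b t a) s.
- by move=> u [/Wx].
- by [].
exists m; split=> // u Wu; apply/negP => mua.
have am : vlt a m by apply: cyc_total => //; apply/negP => ma; apply: no; exists m.
have [bua _ /(_ am)[ua|mu]] := cyc_lt _ _ bma mua; first by apply: no; exists u.
by have := mmax u; rewrite mu => /(_ (conj Wu bua)).
Qed.

Lemma vcross_vcyc a b c d : vcross a b c d ->
  (vcyc d a c && vcyc c b d) || (vcyc d b c && vcyc c a d).
Proof.
have [r [lt _]] := vrank [:: a; b; c; d].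
move=> /vcrossP; rewrite /vcyc /vchain !lt ?inE ?eqxx ?orbT// {lt}.
by case=> -[] /and3P[h1 h2 h3]; lia.
Qed.

Lemma vcyc4_intro a b c d : vcyc d a c -> vcyc c b d -> vcyc4 a c b d.
Proof.
have [r [lt _]] := vrank [:: a; b; c; d].
rewrite /vcyc4 /vcyc !lt ?inE ?eqxx ?orbT// {lt}.
by case/or3P=> /andP[h1 h2]; case/or3P=> /andP[h3 h4]; lia.
Qed.

(* [s] and [t] are the last vertices of [W] before [c] and before [d]. *)
Lemma crossed_max W a b c d : (forall u, W u -> u.2 <= x u.1) -> W a -> W b ->
  vcross a b c d -> exists s t, [/\ W s, W t, vcyc4 s c t d,
    forall u v, W u -> W v -> ~~ vcross u v s c &
    forall u v, W u -> W v -> ~~ vcross u v t d].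
Proof.
move=> Wx Wa Wb cr; wlog /andP[da cb] : a b Wa Wb cr / vcyc d a c && vcyc c b d.
  move=> H; have /orP[h|h] := vcross_vcyc cr; first exact: (H a b).
  by apply: (H b a) => //; rewrite vcrossCl.
have [s [Ws dsc smax]] := vcyc_max Wx Wa da.
have [t [Wt ctd tmax]] := vcyc_max Wx Wb cb.
exists s, t; split=> //; first exact: vcyc4_intro.
- move=> u v Wu Wv; apply/negP => /vcross_vcyc.
  by rewrite (negPf (smax _ Wu)) (negPf (smax _ Wv)) !andbF.
- move=> u v Wu Wv; apply/negP => /vcross_vcyc.
  by rewrite (negPf (tmax _ Wu)) (negPf (tmax _ Wv)) !andbF.
Qed.

End CyclicMaximum.

Section BlockAisles.
Variables (n : nat) (P : {set {set 'I_n}}) (x : 'I_n -> int).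
Hypothesis ncP : noncrossing_partition P.
Implicit Types (u v w a b c d s t : 'I_n * int) (B D : {set 'I_n}).

Definition block_vertex B u := (u.1 \in B) && (u.2 <= x u.1).

Definition block_aisle B u v := [&& varc u v, block_vertex B u & block_vertex B v].

Lemma std_aisleP u v :
  reflect (exists2 B, B \in P & block_aisle B u v) (std_aisle P x u v).
Proof.
apply: (iffP and4P) => [[ar /existsP[B /and3P[BP uB vB]] ux vx]|[B BP]].
  by exists B => //; rewrite /block_aisle /block_vertex ar uB vB ux vx.
move=> /and3P[ar /andP[uB ux] /andP[vB vx]]; split=> //.
by apply/existsP; exists B; rewrite BP uB.
Qed.

(** Vertices of disjoint blocks lie in different segments and are ordered by them, so crossing arcs
    would give crossing blocks. *)
Lemma block_aisle_uncrossed B D u v c d : B \in P -> D \in P -> B != D ->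
  block_aisle B u v -> block_aisle D c d -> ~~ vcross u v c d.
Proof.
move=> BP DP BD /and3P[_ /andP[uB _] /andP[vB _]] /and3P[_ /andP[cD _] /andP[dD _]].
have [/and3P[_ tI _] nc] := ncP.
have dis p q : p \in B -> q \in D -> (p != q :> nat).
  move=> pB qD; apply: contra BD => /eqP/ord_inj pq.
  by rewrite -(finset.def_pblock tI BP pB) pq (finset.def_pblock tI DP qD).
have no (p q r s : 'I_n) : p \in B -> q \in D -> r \in B -> s \in D ->
    ~~ [&& (p < q)%N, (q < r)%N & (r < s)%N].
  move=> pB qD rB sD; apply: contra BD => /and3P[h1 h2 h3]; apply/eqP.
  by apply: (nc p q r s) => //; rewrite h1 h2.
have no' (p q r s : 'I_n) : p \in D -> q \in B -> r \in D -> s \in B ->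
    ~~ [&& (p < q)%N, (q < r)%N & (r < s)%N].
  move=> pB qD rB sD; apply: contra BD => /and3P[h1 h2 h3]; apply/eqP/esym.
  by apply: (nc p q r s) => //; rewrite h1 h2.
have ltBD w z : w.1 \in B -> z.1 \in D -> vlt w z = (w.1 < z.1)%N.
  by move=> wB zD; rewrite /vlt -val_eqE (negPf (dis _ _ wB zD)) orbF.
have ltDB w z : w.1 \in B -> z.1 \in D -> vlt z w = (z.1 < w.1)%N.
  by move=> wB zD; rewrite /vlt -val_eqE eq_sym (negPf (dis _ _ wB zD)) orbF.
apply/negP => /vcrossP; rewrite /vchain !(ltBD u) ?(ltBD v) ?(ltDB u) ?(ltDB v)//.
by case=> -[]; apply/negP; do [exact: no | exact: no'].
Qed.

End BlockAisles.

(** * From arcs to the category *)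

(* The category seen through the vertices ['I_n * int] that enumerate [Z]:
   [e u v] is the indecomposable object of the arc with endpoints [u], [v]. *)
Record arc_model (K : fieldType) (C : triangulated_category K) (n : nat)
    (e : 'I_n * int -> 'I_n * int -> C) : Prop := ArcModel {
  am_krull_schmidt : krull_schmidt C;
  am_sym : forall u v, e u v = e v u;
  am_indec : forall u v, varc u v -> indecomposable (e u v);
  am_indecP : forall X : C, indecomposable X ->
    exists u v, varc u v /\ isomorphic X (e u v);
  am_susp : forall u v, varc u v ->
    isomorphic (susp (e u v)) (e (vsh (-1) u) (vsh (-1) v));
  am_hom_nonzero : forall u v c d, varc u v -> varc c d -> vcross u v c d ->
    exists f : Hom (e u v) (susp (e c d)), f <> 0;
  am_hom_zero : forall u v c d, varc u v -> varc c d -> ~~ vcross u v c d ->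
    hom_zero (e u v) (susp (e c d));
  am_triangle : forall u v c d, varc u v -> varc c d -> vcyc4 u c v d ->
    forall f : Hom (e u v) (susp (e c d)), f <> 0 ->
    exists (X W S : C) (i : Hom (e c d) S) (p : Hom S (e u v)),
      [/\ is_direct_sum X W S, dist i p f,
          varc u c /\ X = e u c \/ is_zero X
        & varc v d /\ W = e v d \/ is_zero W] }.

Section DiscreteClusterModel.
Variables (R : realType) (n : nat) (Z : set (R * R)) (phi : 'I_n * int -> R * R).
Hypotheses (phi_inj : injective phi) (phiZ : forall u, Z (phi u))
  (phi_surj : forall z, Z z -> exists u, phi u = z)
  (phi_cyc : forall u v w, cyc3 (phi u) (phi v) (phi w) <-> vcyc u v w).
Implicit Types u v w a b c d : 'I_n * int.

Lemma is_successorP u (w : R * R) : is_successor Z (phi u) w <-> w = phi (vsh 1 u).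
Proof.
split=> [[_ Zw uw nb]|->].
  have [v vw] := phi_surj Zw; rewrite -vw; congr phi; apply/eqP; apply: contrapT => /negP ne.
  apply: (nb (phi (vsh 1 u))) => //; rewrite -vw; apply/phi_cyc.
  have uv : u != v by apply/eqP => uv; apply: uw; rewrite uv.
  case: u v {vw uw nb} ne uv => [p i] [q j].
  rewrite /vcyc /vsh/= !vltE !xpair_eqE -!val_eqE/=; vlia.
split=> //.
  by move=> /phi_inj; case: u => p i [] /esym; lia.
move=> _ /phi_surj[v <-] /phi_cyc; case: u v => [p i] [q j].
rewrite /vcyc /vsh/= !vltE; vlia.
Qed.

Lemma zsucc_phi u : zsucc Z (phi u) = phi (vsh 1 u).
Proof. by apply: xget_unique => [|y]; rewrite /= is_successorP. Qed.

Lemma zpred_phi u : zpred Z (phi u) = phi (vsh (-1) u).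
Proof.
have E : u = vsh 1 (vsh (-1) u) by rewrite vshD vsh0.
apply: xget_unique => [|y] /=; first by apply/is_successorP; rewrite -E.
move=> succ; have [/phi_surj[v vy] _ _ _] := succ.
by move: succ; rewrite -vy => /is_successorP/phi_inj ->; rewrite vshD vsh0.
Qed.

Lemma set2_eq (T : Type) (a b c d : T) : [set a; b] = [set c; d] ->
  a = c /\ b = d \/ a = d /\ b = c.
Proof.
move=> E.
have [|] : [set c; d] a by rewrite -E; left.
  move=> ac; have [|] : [set c; d] b by rewrite -E; right.
    move=> bc; left; split=> //; have [|] : [set a; b] d by rewrite E; right.
      by move=> ->; rewrite ac.
    by [].
  by move=> bd; left.
move=> ad; have [|] : [set c; d] b by rewrite -E; right.
  by move=> bc; right.
move=> bd; right; split=> //; have [|] : [set a; b] c by rewrite E; left.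
  by move=> ->; rewrite ad.
by [].
Qed.

Lemma arc_pair_phi u v : arc_pair Z (phi u) (phi v) <-> varc u v.
Proof.
rewrite /arc_pair zsucc_phi zpred_phi /varc; split=> [[_ _ h]|/and3P[h1 h2 h3]].
  apply/and3P; split; apply/eqP => vE; apply: h; rewrite vE;
    by [left; left|left; right|right].
by split=> // -[[]|] /phi_inj/eqP; apply/negP.
Qed.

Lemma is_arc_phi u v : is_arc Z [set phi u; phi v] <-> varc u v.
Proof.
split=> [[z0 [z1 [E ap]]]|ar].
  case: (set2_eq E) ap => -[<- <-] /arc_pair_phi //.
  by rewrite varcC.
by exists (phi u), (phi v); split=> //; apply/arc_pair_phi.
Qed.

Lemma cyc4_phi u v c d : cyc4 (phi u) (phi v) (phi c) (phi d) <-> vcyc4 u v c d.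
Proof.
by split=> [[/phi_cyc h1 /phi_cyc h2 /phi_cyc h3 /phi_cyc h4]|
  /and4P[/phi_cyc h1 /phi_cyc h2 /phi_cyc h3 /phi_cyc h4]]; [apply/and4P|].
Qed.

Lemma crossing_phi u v c d :
  crossing [set phi u; phi v] [set phi c; phi d] <-> vcross u v c d.
Proof.
split; last first.
  move=> /orP[] h; exists (phi u), (phi v), (phi c), (phi d); split=> //;
    by [left; apply/cyc4_phi|right; apply/cyc4_phi].
move=> [y0 [y1 [z0 [z1 [s1 s2 cr]]]]]; have E1 := set2_eq s1; have E2 := set2_eq s2.
clear s1 s2.
case: E1 => -[e1 e2]; case: E2 => -[e3 e4]; subst y0 y1 z0 z1;
  case: cr => /cyc4_phi h.
- by rewrite /vcross h.
- by rewrite /vcross h orbT.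
- by rewrite vcrossCr /vcross h.
- by rewrite vcrossCr /vcross h orbT.
- by rewrite vcrossCl /vcross h.
- by rewrite vcrossCl /vcross h orbT.
- by rewrite vcrossCl vcrossCr /vcross h.
- by rewrite vcrossCl vcrossCr /vcross h orbT.
Qed.

Lemma discrete_cluster_arc_model (K : fieldType) (C : triangulated_category K)
    (E : set (R * R) -> C) : discrete_cluster_category Z E ->
  arc_model (fun u v => E [set phi u; phi v]).
Proof.
move=> hC; split.
- exact: dcc_krull_schmidt hC.
- by move=> u v; rewrite setUC.
- by move=> u v /is_arc_phi; exact: dcc_indecomposable hC _.
- move=> X /(dcc_indecomposableP hC)[A [z0 [z1 [-> ap]]] iso].
  have [/phi_surj[u uz] /phi_surj[v vz] _] := ap.
  exists u, v; rewrite uz vz; split=> //.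
  by apply/arc_pair_phi; rewrite uz vz.
- move=> u v /is_arc_phi ar; have := dcc_susp hC ar.
  by rewrite !zpred_phi.
- move=> u v c d /is_arc_phi a1 /is_arc_phi a2 /crossing_phi cr.
  have [f fb] := dcc_hom_crossing hC a1 a2 cr; exists (f 1).
  rewrite -(raddf0 f) => /(bij_inj fb)/eqP; exact/negP/oner_neq0.
- move=> u v c d /is_arc_phi a1 /is_arc_phi a2 ncr.
  by apply: (dcc_hom_noncrossing hC) => // /crossing_phi; exact/negP.
- move=> u v c d /is_arc_phi a1 /is_arc_phi a2 /cyc4_phi cy f f0.
  have [X [W [S [i1 [i2 [p1 [p2 [i [p [hX hW bi di _]]]]]]]]]] :=
    dcc_triangle hC a1 a2 cy f0.
  exists X, W, S, i, p; split=> //.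
  + by exists i1, i2, p1, p2.
  + have [a|a] := boolP (varc u c).
      by left; split=> //; apply: hX.1; exact/is_arc_phi.
    by right; apply: hX.2 => /is_arc_phi; exact/negP.
  + have [a|a] := boolP (varc v d).
      by left; split=> //; apply: hW.1; exact/is_arc_phi.
    by right; apply: hW.2 => /is_arc_phi; exact/negP.
Qed.

End DiscreteClusterModel.

(** * Subcategories and torsion pairs read off on arcs *)

Section ArcModelTheory.
Variables (K : fieldType) (C : triangulated_category K) (n : nat).
Variables (e : 'I_n * int -> 'I_n * int -> C) (hM : arc_model e).
Implicit Types (u v a b c d : 'I_n * int) (X Y S : C) (P Q : set C).
Implicit Types (t : set C * set C).

Lemma arc_ind Q : (forall X, is_zero X -> Q X) ->
  (forall u v X Y S, varc u v -> isomorphic X (e u v) -> is_direct_sum X Y S ->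
    Q Y -> Q S) ->
  forall X, Q X.
Proof.
move=> Q0 QS X; have [s [sX]] := am_krull_schmidt hM X.
(* The default object of [nth] is generalized, since the induction changes [X]. *)
move: {1}X => S0 loc; elim: s X sX loc => [|Y s IH] X /=; first by move=> /Q0.
move=> [S' [sS' sum]] loc.
have [u [v [ar iso]]] := am_indecP hM (local_indecomposable (loc 0%N isT)).
by apply: QS ar iso sum _; apply: IH sS' _ => i; exact: (loc i.+1).
Qed.

Lemma subcategory_le P Q : is_subcategory P -> is_subcategory Q ->
  (forall u v, varc u v -> P (e u v) -> Q (e u v)) -> P `<=` Q.
Proof.
move=> subP subQ PQ; apply: (@arc_ind (fun X => P X -> Q X)) => [X X0 _|].
  by case: subQ => Q0 _ _; exact: Q0.
move=> u v X Y S ar iso sum IH PS; have [_ _ dP] := subP; have [_ sQ _] := subQ.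
have [PX PY] := dP _ _ _ sum PS; apply: sQ sum _ (IH PY).
apply: (subcategory_iso subQ (isomorphic_sym iso)); apply: PQ ar _.
exact: subcategory_iso iso PX.
Qed.

Lemma arc_susp_up u v : varc u v ->
  isomorphic (susp (e (vsh 1 u) (vsh 1 v))) (e u v).
Proof. by rewrite -(varc_vsh 1) => /(am_susp hM); rewrite !vshD !vsh0. Qed.

Lemma arc_iter_susp (m : nat) u v : varc u v ->
  isomorphic (iter m susp (e u v)) (e (vsh (- m%:Z) u) (vsh (- m%:Z) v)).
Proof.
move=> ar; elim: m => [|m IH] /=; first by rewrite oppr0 !vsh0; exact: isomorphic_refl.
apply: isomorphic_trans; first by apply/susp_isomorphic; exact: IH.
have := am_susp hM (u := vsh (- m%:Z) u) (v := vsh (- m%:Z) v).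
rewrite varc_vsh !vshD => /(_ ar).
by have -> : - m%:Z + -1 = - m.+1%:Z by lia.
Qed.

Lemma susp_sub_arc k P u v : is_subcategory P -> varc u v ->
  susp_sub k P (e u v) <-> P (e (vsh k u) (vsh k v)).
Proof.
move=> subP ar; case: k => m /=.
  have iso : isomorphic (iter m susp (e (vsh m%:Z u) (vsh m%:Z v))) (e u v).
    have := arc_iter_susp m (u := vsh m%:Z u) (v := vsh m%:Z v).
    by rewrite varc_vsh !vshD subrr !vsh0 => /(_ ar).
  split=> [[Y PY uY]|Pu]; last by exists (e (vsh m%:Z u) (vsh m%:Z v)) => //; exact: isomorphic_sym.
  apply: subcategory_iso subP _ PY; apply/(iter_susp_isomorphic m)/isomorphic_sym.
  exact: isomorphic_trans iso uY.
have := arc_iter_susp m.+1 ar; rewrite NegzE => iso; split; apply: subcategory_iso => //.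
exact: isomorphic_sym.
Qed.

(** Suspension lowers endpoints, so the target is the suspension of the arc raised by one; this is
    the source of the shifts by one below. *)
Lemma arc_hom_zero u v c d : varc u v -> varc c d ->
  hom_zero (e u v) (e c d) <-> ~~ vcross u v (vsh 1 c) (vsh 1 d).
Proof.
move=> a1 a2; have iso := arc_susp_up a2; rewrite -(varc_vsh 1) in a2.
split=> [h|ncr]; last exact: hom_zero_isor iso (am_hom_zero hM a1 a2 ncr).
apply/negP => cr; have [f] := am_hom_nonzero hM a1 a2 cr; apply.
exact: hom_zero_isor (isomorphic_sym iso) h f.
Qed.

Definition arcs_of P u v := varc u v /\ P (e u v).

Lemma right_perp_arc P c d : is_subcategory P -> varc c d ->
  right_perp P (e c d) <-> ~ crossed (arcs_of P) (vsh 1 c) (vsh 1 d).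
Proof.
move=> subP ar; split=> [h [u [v [[a1 Pu] cr]]]|nc X PX].
  by move: cr; apply/negP/arc_hom_zero => //; exact: h.
suff le : P `<=` left_perp [set e c d] by exact: le PX _ erefl.
apply: subcategory_le subP (left_perp_subcategory _) _ => u v a1 Pu Y ->.
by apply/arc_hom_zero => //; apply/negP => cr; apply: nc; exists u, v.
Qed.

Lemma left_perp_arc P u v : is_subcategory P -> varc u v ->
  left_perp P (e u v) <->
  forall c d, arcs_of P c d -> ~~ vcross u v (vsh 1 c) (vsh 1 d).
Proof.
move=> subP ar; split=> [h c d [a1 Pc]|nc Y PY].
  by apply/arc_hom_zero => //; exact: h.
suff le : P `<=` right_perp [set e u v] by exact: le PY _ erefl.
apply: subcategory_le subP (right_perp_subcategory _) _ => c d a1 Pc X ->.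
by apply/arc_hom_zero => //; apply: nc.
Qed.

Lemma coaisle_arc t c d : is_torsion_pair t -> varc c d ->
  t.2 (e c d) <-> ~ crossed (arcs_of t.1) (vsh 1 c) (vsh 1 d).
Proof.
move=> tp ar; have [-> _] := torsion_pair_perp tp; apply: right_perp_arc => //.
by case: tp.
Qed.

Lemma aisle_arc t u v : is_torsion_pair t -> varc u v ->
  (forall c d, varc c d -> vcross u v c d -> crossed (arcs_of t.1) c d) ->
  t.1 (e u v).
Proof.
move=> tp ar H; have [_ t1] := torsion_pair_perp tp.
have sub2 : is_subcategory t.2 by case: tp.
rewrite t1; apply/left_perp_arc => // c d [acd t2]; apply/negP => cr.
by move/(coaisle_arc tp acd): t2; apply; apply: H => //; rewrite varc_vsh.
Qed.

Lemma bigcap_susp_zeroP P : is_subcategory P ->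
  \bigcap_(k in [set: int]) susp_sub k P = zero_subcategory (C := C) <->
  forall u v, varc u v -> exists k, ~ P (e (vsh k u) (vsh k v)).
Proof.
move=> subP; split=> [E u v ar|H].
  apply/existsNP => all; have [e0 _] := am_indec hM ar; apply: e0.
  have : zero_subcategory (e u v); last by [].
  by rewrite -E => k _; apply/susp_sub_arc.
apply/seteqP; split=> [X|X X0 k _]; last first.
  by case: (susp_sub_subcategory k subP) => P0 _ _; exact: P0.
pose Q S := (\bigcap_(k in [set: int]) susp_sub k P) S -> is_zero S.
apply: (@arc_ind Q) X => [X X0 _|u v X Y S ar iso sum _ PS]; first exact: X0.
have [k nk] := H _ _ ar; exfalso; apply: nk; apply/(susp_sub_arc k subP ar).
have subk := susp_sub_subcategory k subP; have [_ _ dk] := subk.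
apply: (subcategory_iso subk iso).
by have [] := dk _ _ _ sum (PS k I).
Qed.

Lemma nondegenerateP t : is_torsion_pair t -> nondegenerate_tpair t <->
  (forall u v, varc u v -> exists k, ~ t.1 (e (vsh k u) (vsh k v))) /\
  (forall u v, varc u v -> exists k, crossed (arcs_of t.1) (vsh k u) (vsh k v)).
Proof.
move=> tp; have [sub1 sub2 _ _] := tp.
rewrite /nondegenerate_tpair (bigcap_susp_zeroP sub1) (bigcap_susp_zeroP sub2).
split=> -[h1 h2]; split=> // u v ar; have [k hk] := h2 _ _ ar.
  exists (k + 1); apply: contrapT => nc; apply: hk.
  by apply/(coaisle_arc tp); rewrite ?varc_vsh// !vshD.
exists (k - 1) => /(coaisle_arc tp); rewrite varc_vsh => /(_ ar).
by rewrite !vshD subrK.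
Qed.

Lemma tstructure_arc_aisle t : is_tstructure t -> nondegenerate_tpair t ->
  arc_aisle (arcs_of t.1).
Proof.
move=> [tp St] /(nondegenerateP tp)[nd1 nd2]; have sub1 : is_subcategory t.1 by case: tp.
split=> //.
- by move=> u v [].
- by move=> u v [ar tu]; split; [rewrite varcC|rewrite (am_sym hM)].
- by move=> u v ar H; split=> //; exact: aisle_arc.
- move=> u v [ar tu]; split; first by rewrite varc_vsh.
  apply: St; apply/susp_sub_arc => //; first by rewrite varc_vsh.
  by rewrite !vshD !vsh0.
- by move=> u v /nd1[k nk]; exists k => -[].
Qed.

Lemma arc_aisle_nondegenerate t : is_torsion_pair t -> arc_aisle (arcs_of t.1) ->
  nondegenerate_tpair t.
Proof.
move=> tp aa; apply/(nondegenerateP tp); split=> u v ar.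
  have [k nk] := aa_nondeg aa ar; exists k => tk; apply: nk; split=> //.
  by rewrite varc_vsh.
exact: aa_conondeg aa _ _ ar.
Qed.

End ArcModelTheory.

(** * Construction of the t-structure of a partition and heights *)

Section Existence.
Variables (K : fieldType) (C : triangulated_category K) (n : nat).
Variables (e : 'I_n * int -> 'I_n * int -> C) (hM : arc_model e).
Implicit Types (u v a b c d : 'I_n * int) (X Y S : C) (B D : {set 'I_n}).

Definition arc_objects (X : 'I_n * int -> 'I_n * int -> Prop) : set C :=
  [set S | exists u v, X u v /\ S = e u v].

Lemma block_approximation (x : 'I_n -> int) B a b : varc a b ->
  exists (X : C) (f : Hom X (e a b)), approximation (arc_objects (block_aisle x B)) f /\
    (is_zero X \/ arc_objects (block_aisle x B) X).
Proof.
move=> ar; set Q := arc_objects _.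
have ar1 : varc (vsh 1 a) (vsh 1 b) by rewrite varc_vsh.
have [[u [v [/and3P[uv uB vB] cr]]]|nc] :=
  pselect (crossed (block_aisle x B) (vsh 1 a) (vsh 1 b)); last first.
  have [[N N0] _] := tcat_additive C.
  exists N, 0; split; last by left.
  apply: approximation_zero => // S [u [v [uv ->]]]; apply/(arc_hom_zero hM) => //.
    by have /and3P[] := uv.
  by apply/negP => cr; apply: nc; exists u, v.
have Wx w : block_vertex x B w -> w.2 <= x w.1 by case/andP.
have [s [t [sB tB cy ncs nct]]] := crossed_max Wx uB vB cr.
have crst : vcross s t (vsh 1 a) (vsh 1 b) by rewrite /vcross cy.
have arst := vcross_arc crst.
have [f f0] := am_hom_nonzero hM arst ar1 crst.
have [X [W [S [i [p [sum ipf hX hW]]]]]] := am_triangle hM arst ar1 cy f0.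
have [g gi] := arc_susp_up hM ar.
exists (e s t), (g \oC f); split; last first.
  by right; exists s, t; rewrite /block_aisle arst sB tB.
apply: approximation_iso => //.
(* After rotation the cone of [f] is [susp S]; by [ncs] and [nct] no arc of the block crosses either
   summand of [S]. *)
have /dist_rotate fip : dist p f (- suspm i) by move/dist_rotate: ipf.
apply/(approximation_cone Q fip).
move=> _ [w [z [/and3P[wz wB zB] ->]]].
move/susp_direct_sum: sum => sum; apply/(hom_zero_sumr _ sum); split.
  case: hX => [[ax ->]|X0]; first by apply: (am_hom_zero hM) => //; exact: ncs.
  by move=> h; apply: is_zero_to; apply/susp_zero.
case: hW => [[ax ->]|W0]; first by apply: (am_hom_zero hM) => //; exact: nct.
by move=> h; apply: is_zero_to; apply/susp_zero.
Qed.

Variables (P : {set {set 'I_n}}) (x : 'I_n -> int).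
Hypothesis ncP : noncrossing_partition P.

Let Q : set C := arc_objects (std_aisle P x).

Lemma left_perp_right_perp (R : set C) X : R X -> left_perp (right_perp R) X.
Proof. by move=> RX Y; apply. Qed.

(** The last conclusion is the induction invariant: it supplies the orthogonality under which
    [approximation_union] can add one more block. *)
Lemma blocks_approximation (bs : seq {set 'I_n}) a b : varc a b ->
  uniq bs -> {subset bs <= P} ->
  exists (X : C) (f : Hom X (e a b)), [/\
    approximation [set S | exists2 B, B \in bs & arc_objects (block_aisle x B) S] f,
    left_perp (right_perp Q) X &
    forall D, D \in P -> D \notin bs -> forall S, arc_objects (block_aisle x D) S ->
      hom_zero S (susp X)].
Proof.
move=> ar; elim: bs => [_ _|B bs IH /= /andP[Bbs ubs] sub].
  have [[N N0] _] := tcat_additive C.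
  exists N, 0; split.
  - by move=> S [].
  - by move=> Y _ f; exact: is_zero_from.
  - by move=> D _ _ S _ f; apply: is_zero_to; apply/susp_zero.
have BP : B \in P by apply: sub; rewrite mem_head.
have [|X [f [af PX hX]]] := IH ubs.
  by move=> D Dbs; apply: sub; rewrite inE Dbs orbT.
have [Y [g [ag hY]]] := block_approximation x B ar.
have PY : left_perp (right_perp Q) Y.
  case: hY => [Y0 W _ h|[u [v [uv ->]]]]; first exact: is_zero_from.
  by apply: left_perp_right_perp; exists u, v; split=> //; apply/std_aisleP; exists B.
have QY D : D \in P -> D != B -> forall S, arc_objects (block_aisle x D) S ->
    hom_zero S (susp Y).
  move=> DP DB _ [c [d [cd ->]]].
  case: hY => [Y0 h|[u [v [uv ->]]]]; first by apply: is_zero_to; apply/susp_zero.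
  have /and3P[acd _ _] := cd; have /and3P[auv _ _] := uv.
  apply: (am_hom_zero hM) => //; exact: (block_aisle_uncrossed ncP DP BP DB cd uv).
have [|V [h [sum ah]]] := approximation_union ag af (hX B BP Bbs).
  move=> S [D Dbs SD]; apply: (QY D) => //.
    by apply: sub; rewrite inE Dbs orbT.
  by apply: contra Bbs => /eqP <-.
exists V, h; split.
- move=> S [D]; rewrite inE => /orP[/eqP ->|Dbs] SD; apply: ah; first by left.
  by right; exists D.
- by have [_ sumP _] := left_perp_subcategory (right_perp Q); exact: sumP sum PY PX.
- move=> D DP; rewrite inE negb_or => /andP[DB Dbs] S SD.
  move/susp_direct_sum: sum => sum; apply/(hom_zero_sumr _ sum); split.
    exact: QY SD.
  exact: hX SD.
Qed.

Lemma std_approximation Z : exists (X : C) (f : Hom X Z),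
  left_perp (right_perp Q) X /\ approximation Q f.
Proof.
move: Z; apply: (arc_ind hM) => [Z Z0|u v Z Y S ar [g [g' [gg' g'g]]] sum [X [f [PX af]]]].
  exists Z, 0; split; first by move=> Y _ f; exact: is_zero_from.
  by apply: approximation_zero => // S _ f; exact: is_zero_to.
have [|X1 [f1 [af1 PX1 _]]] := @blocks_approximation (enum P) u v ar (enum_uniq _).
  by move=> B; rewrite mem_enum.
have af1' : approximation Q f1.
  move=> W [c [d [/std_aisleP[B BP cd] ->]]]; apply: af1; exists B; first by rewrite mem_enum.
  by exists c, d.
have ig' : is_iso g' by exists g.
have af2 : approximation Q (g' \oC f1) by exact: approximation_iso ig' af1'.
have [V [h [sumV ah]]] := approximation_sum sum af2 af.
exists V, h; split=> //.
by have [_ sumP _] := left_perp_subcategory (right_perp Q); exact: sumP sumV PX1 PX.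
Qed.

Theorem std_tstructure : exists t : set C * set C, is_tstructure t /\
  forall u v, varc u v -> t.1 (e u v) <-> std_aisle P x u v.
Proof.
exists (left_perp (right_perp Q), right_perp Q).
have tp := approximation_torsion_pair std_approximation.
have QX u v : std_aisle P x u v -> Q (e u v) by move=> uv; exists u, v.
have nd := std_arc_aisle x ncP.
split; [split=> //|move=> u v ar /=; split].
(* As [Q] is closed under suspension, its right orthogonal is closed under desuspension, and the
   left orthogonal of that under suspension again. *)
- move=> X [Y PY XY] W QW; apply: hom_zero_isol (isomorphic_sym XY) _.
  have [W' iso] := susp_surj W; apply: (hom_zero_isor iso); apply/hom_zero_susp.
  apply: PY => _ [u [v [uv ->]]]; apply/hom_zero_susp.
  apply: hom_zero_isor (isomorphic_sym iso) _.
  apply: hom_zero_isol (isomorphic_sym (am_susp hM (aa_arc nd uv))) _.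
  by apply: QW; apply: QX; exact: aa_susp nd _ _ uv.
- move=> h; apply: (aa_nc nd) => // c d acd cr; apply: contrapT => nc.
  have acd' : varc (vsh (-1) c) (vsh (-1) d) by rewrite varc_vsh.
  have : hom_zero (e u v) (e (vsh (-1) c) (vsh (-1) d)).
    apply: h => _ [w [z [wz ->]]]; apply/(arc_hom_zero hM) => //; first exact: aa_arc nd _ _ wz.
    by apply/negP; rewrite !vshD !vsh0 => cr'; apply: nc; exists w, z.
  by move/(arc_hom_zero hM ar acd'); rewrite !vshD !vsh0 cr.
- by move=> uv; apply: left_perp_right_perp; exact: QX.
Qed.

End Existence.

(** * Equivalence classes of t-structures *)

Section Transport.
Variables (T T' : Type) (D : set T) (le : T -> T -> Prop).
Variables (D' : set T') (le' : T' -> T' -> Prop) (F : T -> T').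
Hypotheses (bijF : set_bij D D' F)
  (monoF : forall x y, D x -> D y -> le x y <-> le' (F x) (F y)).

Lemma transport_lattice : is_lattice D' le' -> is_lattice D le.
Proof.
have [funF injF surF] := bijF; move=> [refl anti trans meet join].
split.
- by move=> x Dx; apply/monoF => //; apply: refl; exact: funF.
- move=> x y Dx Dy /(monoF Dx Dy) xy /(monoF Dy Dx) yx.
  apply: (injF _ _ (mem_set Dx) (mem_set Dy)).
  exact: anti (funF _ Dx) (funF _ Dy) xy yx.
- move=> x y z Dx Dy Dz /(monoF Dx Dy) xy /(monoF Dy Dz) yz; apply/monoF => //.
  exact: trans (funF _ Dx) (funF _ Dy) (funF _ Dz) xy yz.
- move=> x y Dx Dy; have [m [/surF[w Dw <-] mx my mz]] := meet _ _ (funF _ Dx) (funF _ Dy).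
  exists w; split=> //; [exact/monoF|exact/monoF|].
  by move=> z Dz /(monoF Dz Dx) zx /(monoF Dz Dy) zy; apply/monoF => //; exact: mz (funF _ Dz) zx zy.
- move=> x y Dx Dy; have [m [/surF[w Dw <-] mx my mz]] := join _ _ (funF _ Dx) (funF _ Dy).
  exists w; split=> //; [exact/monoF|exact/monoF|].
  by move=> z Dz /(monoF Dx Dz) zx /(monoF Dy Dz) zy; apply/monoF => //; exact: mz (funF _ Dz) zx zy.
Qed.

End Transport.

Section Classes.
Variables (K : fieldType) (C : triangulated_category K) (n : nat).
Variables (e : 'I_n * int -> 'I_n * int -> C) (hM : arc_model e).
Implicit Types (u v a b c d : 'I_n * int) (p q : 'I_n) (P : {set {set 'I_n}}).
Implicit Types (x : 'I_n -> int) (t : set C * set C).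

Definition std_form P x t := forall u v, varc u v ->
  t.1 (e u v) <-> std_aisle P x u v.

Definition partition_class P : set (set C * set C) :=
  [set t | is_tstructure t /\ exists x, std_form P x t].

Lemma std_form_arcs P x t u v : std_form P x t ->
  arcs_of e t.1 u v <-> std_aisle P x u v.
Proof.
move=> tx; split=> [[ar /tx]|uv]; first exact.
by have /and4P[ar _ _ _] := uv; split=> //; apply/tx.
Qed.

Lemma std_form_crossed P x t c d : std_form P x t ->
  crossed (arcs_of e t.1) c d <-> crossed (std_aisle P x) c d.
Proof.
by move=> tx; split=> -[a [b [/(std_form_arcs _ _ tx) ab cr]]]; exists a, b.
Qed.

Lemma arc_aisle_ext (X Y : 'I_n * int -> 'I_n * int -> Prop) :
  (forall u v, X u v <-> Y u v) -> arc_aisle X -> arc_aisle Y.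
Proof.
by move=> XY; have -> // : X = Y by apply/funext => u; apply/funext => v; apply/propext.
Qed.

Lemma std_form_nondegenerate P x t : noncrossing_partition P -> is_tstructure t ->
  std_form P x t -> nondegenerate_tpair t.
Proof.
move=> nP [tp _] tx; apply: (arc_aisle_nondegenerate hM tp).
apply: arc_aisle_ext (std_arc_aisle x nP) => u v.
exact: iff_sym (std_form_arcs _ _ tx).
Qed.

Lemma nondegenerate_std_form t : is_tstructure t -> nondegenerate_tpair t ->
  exists P x, noncrossing_partition P /\ std_form P x t.
Proof.
move=> ts nd; have [P [x [nP h]]] := arc_aisle_classification (tstructure_arc_aisle hM ts nd).
exists P, x; split=> // u v ar; rewrite -h.
by split=> [|[]].
Qed.

Lemma susp_sub_le k l (A B : set C) : is_subcategory A -> is_subcategory B ->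
  susp_sub k A `<=` susp_sub l B <->
  forall u v, varc u v -> A (e (vsh k u) (vsh k v)) -> B (e (vsh l u) (vsh l v)).
Proof.
move=> sA sB; split=> [AB u v ar Au|AB].
  by apply/(susp_sub_arc hM _ sB ar); apply: AB; apply/(susp_sub_arc hM _ sA ar).
apply: (subcategory_le hM (susp_sub_subcategory k sA) (susp_sub_subcategory l sB)).
by move=> u v ar /(susp_sub_arc hM _ sA ar)/AB h; apply/(susp_sub_arc hM _ sB ar)/h.
Qed.

Lemma susp_sub0 (A : set C) : is_subcategory A -> susp_sub 0 A = A.
Proof.
move=> sA; apply/seteqP; split=> [X [Y AY XY]|X AX].
  exact: (subcategory_iso sA (isomorphic_sym XY)).
by exists X => //; exact: isomorphic_refl.
Qed.

Lemma tequivP t t' : is_subcategory t.1 -> is_subcategory t'.1 -> tequiv t t' <->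
  exists2 N : nat, (0 < N)%N & forall u v, varc u v ->
    (t.1 (e u v) -> t'.1 (e (vsh (- N%:Z) u) (vsh (- N%:Z) v))) /\
    (t'.1 (e u v) -> t.1 (e (vsh (- N%:Z) u) (vsh (- N%:Z) v))).
Proof.
move=> s1 s2; split=> -[N N0 H]; exists N => //; last first.
  rewrite -(susp_sub0 s2); split; apply/susp_sub_le => // u v ar.
    move=> tu; have := H (vsh N%:Z u) (vsh N%:Z v).
    by rewrite varc_vsh !vshD subrr !vsh0 => /(_ ar)[+ _]; apply.
  by rewrite !vsh0; have [] := H u v ar.
move=> u v ar; move: H; rewrite -{1 2}(susp_sub0 s2) !susp_sub_le// => -[h1 h2].
split=> [tu|tu]; last by have := h2 u v ar; rewrite !vsh0; apply.
have := h1 (vsh (- N%:Z) u) (vsh (- N%:Z) v).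
by rewrite varc_vsh !vshD addNr addr0 !vsh0; apply.
Qed.

(** Shifts preserve segments, so two segments of one block are recognized by the arc joining their
    highest admissible vertices. *)
Lemma std_aisle_refines P P' x x' (k : int) :
  noncrossing_partition P -> noncrossing_partition P' ->
  (forall u v, std_aisle P x u v -> std_aisle P' x' (vsh k u) (vsh k v)) -> refines P P'.
Proof.
move=> nP nP' H; apply/refinesP => // p q pq.
have [<-|npq] := eqVneq p q; first exact: same_block_refl.
have := H (p, x p) (q, x q); rewrite /std_aisle varcE !lexx pq.
by rewrite -val_eqE/= in npq; rewrite npq => /(_ isT)/and4P[].
Qed.

Lemma tequiv_std_form P x t t' : noncrossing_partition P -> is_tstructure t ->
  is_tstructure t' -> std_form P x t -> tequiv t t' <-> exists x', std_form P x' t'.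
Proof.
move=> nP ts ts' tx.
have s1 : is_subcategory t.1 by case: ts => -[].
have s2 : is_subcategory t'.1 by case: ts' => -[].
split=> [/(tequivP s1 s2)[N N0 H]|[x' tx']].
  have [tp _] := ts; have [tp' _] := ts'.
  have := std_form_nondegenerate nP ts tx; rewrite (nondegenerateP hM tp) => -[nd1 nd2].
  (* Non-degeneracy passes to equivalent t-structures by adjusting the shift by [N], so [t'] has a
     standard form, whose partition is then compared with [P]. *)
  have nd' : nondegenerate_tpair t'.
    apply/(nondegenerateP hM tp'); split=> u v ar.
      have [k nk] := nd1 _ _ ar; exists (k + N%:Z) => tk; apply: nk.
      have := H (vsh (k + N%:Z) u) (vsh (k + N%:Z) v).
      by rewrite varc_vsh !vshD addrK => /(_ ar)[_]; apply.
    have [k [a [b [[ab tab] cr]]]] := nd2 _ _ ar.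
    exists (k - N%:Z), (vsh (- N%:Z) a), (vsh (- N%:Z) b); split.
      by split; [rewrite varc_vsh|apply: (H _ _ ab).1].
    by rewrite -!vshD vcross_vsh.
  have [P' [x' [nP' tx']]] := nondegenerate_std_form ts' nd'.
  exists x'; suff -> : P = P' by [].
  apply: refines_anti => //.
    apply: (@std_aisle_refines _ _ x x' (- N%:Z)) => // u v uv.
    have /and4P[ar _ _ _] := uv; apply/tx'; first by rewrite varc_vsh.
    by apply: (H _ _ ar).1; apply/tx.
  apply: (@std_aisle_refines _ _ x' x (- N%:Z)) => // u v uv.
  have /and4P[ar _ _ _] := uv; apply/tx; first by rewrite varc_vsh.
  by apply: (H _ _ ar).2; apply/tx'.
(* There are finitely many segments, so one shift dominates all differences of heights; the
   successor makes it positive. *)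
apply/tequivP => //; pose N := (\sum_(p < n) `|(x p - x' p)%R|).+1%N.
have HN p : (`|(x p - x' p)%R| <= N)%N.
  by rewrite /N (bigD1 p)//=; lia.
exists N => // u v ar.
split=> /[dup] tu; [move/tx => /(_ ar)|move/tx' => /(_ ar)] => /and4P[_ uv ux vx];
  [apply/tx'|apply/tx]; rewrite /std_aisle ?varc_vsh// ar uv /=;
  by have := HN u.1; have := HN v.1; lia.
Qed.

Lemma tclass_std_form P x t : noncrossing_partition P -> is_tstructure t ->
  std_form P x t -> tclass t = partition_class P.
Proof.
move=> nP ts tx; apply/seteqP; split=> t' [ts' h]; split=> //.
  exact/(tequiv_std_form nP ts ts' tx).
exact/(tequiv_std_form nP ts ts' tx).
Qed.

Lemma nondegenerate_classesP (cl : set (set C * set C)) :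
  nondegenerate_classes C cl <->
  exists2 P, noncrossing_partition P & cl = partition_class P.
Proof.
split=> [[t [ts nd ->]]|[P nP ->]].
  have [P [x [nP tx]]] := nondegenerate_std_form ts nd.
  by exists P => //; exact: tclass_std_form tx.
have [t [ts tx]] := std_tstructure hM (fun=> 0) nP.
exists t; split=> //; first exact: std_form_nondegenerate tx.
by apply/esym; exact: tclass_std_form tx.
Qed.

Lemma partition_class_le P P' : noncrossing_partition P -> noncrossing_partition P' ->
  tclass_le (partition_class P) (partition_class P') <-> refines P P'.
Proof.
move=> nP nP'; split=> [le|ref].
  have [t [ts tx]] := std_tstructure hM (fun=> 0) nP.
  have [|t' [ts' [x' tx']] tt'] := le t; first by split=> //; exists (fun=> 0).
  apply: (@std_aisle_refines _ _ (fun=> 0) x' 0) => // u v uv; rewrite !vsh0.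
  by have /and4P[ar _ _ _] := uv; apply/tx' => //; apply: tt'; apply/tx.
(* Keeping the heights of [t] while coarsening the blocks can only enlarge the aisle. *)
move=> t [ts [x tx]]; have [t' [ts' tx']] := std_tstructure hM x nP'.
exists t'; first by split=> //; exists x.
have s1 : is_subcategory t.1 by case: ts => -[].
have s2 : is_subcategory t'.1 by case: ts' => -[].
apply: (subcategory_le hM s1 s2) => u v ar /tx => /(_ ar) /and4P[_ uv ux vx].
apply/tx' => //; rewrite /std_aisle ar ux vx !andbT /=.
by move/(refinesP nP nP'): ref; apply.
Qed.

Lemma partition_class_inj P P' : noncrossing_partition P -> noncrossing_partition P' ->
  partition_class P = partition_class P' -> P = P'.
Proof.
move=> nP nP' E; apply: refines_anti => //; apply/partition_class_le => //;
  by rewrite E => t ht; exists t.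
Qed.

Lemma classes_isomorphic : lattice_isomorphic
  (nondegenerate_classes C) tclass_le
  [set P : {set {set 'I_n}} | noncrossing_partition P] (@refines n).
Proof.
pose F (cl : set (set C * set C)) : {set {set 'I_n}} :=
  xget finset.set0 [set P | noncrossing_partition P /\ cl = partition_class P].
have FP cl : nondegenerate_classes C cl ->
    noncrossing_partition (F cl) /\ cl = partition_class (F cl).
  move=> /nondegenerate_classesP[P nP clP].
  exact: (@xgetPex _ _ [set P | noncrossing_partition P /\ cl = partition_class P]
    (ex_intro _ P (conj nP clP))).
have Fbij : set_bij (nondegenerate_classes C)
    [set P : {set {set 'I_n}} | noncrossing_partition P] F.
  split.
  - by move=> cl /FP[].
  - move=> cl cl' /set_mem/FP[_ h] /set_mem/FP[_ h'] E.
    by rewrite h h' E.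
  - move=> P nP; exists (partition_class P); first by apply/nondegenerate_classesP; exists P.
    have [|nF /esym] := FP (partition_class P); first by apply/nondegenerate_classesP; exists P.
    exact: partition_class_inj.
have Fmono cl cl' : nondegenerate_classes C cl -> nondegenerate_classes C cl' ->
    tclass_le cl cl' <-> refines (F cl) (F cl').
  by move=> /FP[n1 {1}->] /FP[n2 {1}->]; exact: partition_class_le.
have latP := @noncrossing_lattice n.
split=> //; first exact: transport_lattice Fbij Fmono latP.
by exists F.
Qed.

(** Directedness of the shifts makes their union closed under direct sums, so it can be tested on
    arcs. *)
Lemma bigcup_suspP (A : set C) : is_subcategory A ->
  (forall k l, exists m, susp_sub k A `<=` susp_sub m A /\ susp_sub l A `<=` susp_sub m A) ->
  \bigcup_(k in [set: int]) susp_sub k A = [set: C] <->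
  forall u v, varc u v -> exists k, A (e (vsh k u) (vsh k v)).
Proof.
move=> sA dir; split=> [E u v ar|H].
  have : [set: C] (e u v) by [].
  by rewrite -E => -[k _ /(susp_sub_arc hM _ sA ar)]; exists k.
apply/seteqP; split=> // X _; pose Q X := (\bigcup_(k in [set: int]) susp_sub k A) X.
apply: (@arc_ind _ _ _ _ hM Q) X => [X X0|u v X Y S ar iso sum [l _ Yl]].
  by exists 0 => //; have [h _ _] := susp_sub_subcategory 0 sA; exact: h.
have [k /(susp_sub_arc hM _ sA ar) hk] := H _ _ ar.
have [m [km lm]] := dir k l; exists m => //.
have sm := susp_sub_subcategory m sA; have [_ sD _] := sm.
apply: sD sum _ (lm _ Yl); apply: km.
exact: subcategory_iso (susp_sub_subcategory k sA) (isomorphic_sym iso) hk.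
Qed.

Lemma arc_aisle_down (X : 'I_n * int -> 'I_n * int -> Prop) (m : nat) u v :
  arc_aisle X -> X u v -> X (vsh (- m%:Z) u) (vsh (- m%:Z) v).
Proof.
move=> aX Xuv; elim: m => [|m /(aa_susp aX)]; first by rewrite oppr0 !vsh0.
by rewrite !vshD; have -> : - m%:Z + -1 = - m.+1%:Z by lia.
Qed.

(** Suspending an arc lowers its ends below any heights but never changes their segments. *)
Lemma bounded_aboveP P x t : noncrossing_partition P -> is_tstructure t ->
  std_form P x t -> bounded_above t <-> forall p q, same_block P p q.
Proof.
move=> nP ts tx; have s1 : is_subcategory t.1 by case: ts => -[].
have aX := std_arc_aisle x nP.
rewrite /bounded_above bigcup_suspP//; last first.
  have down (k l : int) : l <= k -> susp_sub k t.1 `<=` susp_sub l t.1.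
    move=> lk; apply/susp_sub_le => // u v ar /tx; rewrite varc_vsh => /(_ ar) uv.
    apply/tx; first by rewrite varc_vsh.
    have := arc_aisle_down (`|(k - l)%R|%N) aX uv; rewrite !vshD.
    by have -> : k - `|(k - l)%R|%N%:Z = l by lia.
  by move=> k l; exists (Num.min k l); split; apply: down; lia.
split=> [H p q|all u v ar].
  have [<-|npq] := eqVneq p q; first exact: same_block_refl.
  have ar : varc (p, 0) (q, 0) by rewrite varcE -[X in _ || X]orbF; rewrite val_eqE npq.
  have [k /tx] := H _ _ ar.
  by rewrite varc_vsh => /(_ ar)/and4P[].
exists (Num.min (x u.1 - u.2) (x v.1 - v.2)); apply/tx; first by rewrite varc_vsh.
by rewrite /std_aisle varc_vsh ar all /=; lia.
Qed.

(** All vertices between the two ends lie in segment [p] below [x p], so neither [u] nor [v] is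
    among them. *)
Lemma same_segment_uncrossed x p (i j : int) u v : i <= x p -> j <= x p ->
  x u.1 < u.2 -> x v.1 < v.2 -> ~~ vcross (p, i) (p, j) u v.
Proof.
case: u v => [q k] [r l] /= ip jp qk rl.
have E (s : 'I_n) m : x s < m -> s = p :> nat -> x p < m by move=> ? /ord_inj <-.
move: (E q k qk) (E r l rl); rewrite vcross_btw /vbtw !vltE !xpair_eqE -!val_eqE/=.
by move: (x p) ip jp {E qk rl} => xp ip jp; vlia.
Qed.

(** With singleton blocks every arc of the aisle stays in one segment, and arcs with both ends above
    the heights escape it. If [p] and [q] share a block, all shifts of the arc joining them remain
    crossed. *)
Lemma bounded_belowP P x t : noncrossing_partition P -> is_tstructure t ->
  std_form P x t -> bounded_below t <-> forall p q, same_block P p q -> p = q.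
Proof.
move=> nP ts tx; have [tp _] := ts; have s2 : is_subcategory t.2 by case: tp.
have aX := std_arc_aisle x nP.
have t2 c d : varc c d -> t.2 (e c d) <-> ~ crossed (std_aisle P x) (vsh 1 c) (vsh 1 d).
  by move=> ar; rewrite (coaisle_arc hM tp ar) (std_form_crossed _ _ tx).
rewrite /bounded_below bigcup_suspP//; last first.
  have up (k l : int) : k <= l -> susp_sub k t.2 `<=` susp_sub l t.2.
    move=> kl; apply/susp_sub_le => // u v ar; rewrite !t2 ?varc_vsh// => nc.
    move=> [a [b [ab cr]]]; apply: nc; pose m := `|(l - k)%R|%N.
    exists (vsh (- m%:Z) a), (vsh (- m%:Z) b); split; first exact: (arc_aisle_down m aX ab).
    rewrite -(vcross_vsh m%:Z); move: cr; rewrite !vshD addNr !vsh0.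
    by have -> : k + (1 + m%:Z) = l + 1 by rewrite /m; lia.
  by move=> k l; exists (Num.max k l); split; apply: up; lia.
split=> [H p q pq|sing u v ar].
  apply/eqP; apply: contrapT => /negP npq.
  have ar : varc (p, 0) (q, 0) by rewrite varcE -[X in _ || X]orbF; rewrite val_eqE npq.
  have [k] := H _ _ ar; rewrite t2 ?varc_vsh//; apply; rewrite !vshD.
  have npq' : p != q :> nat by rewrite val_eqE.
  (* An end below the height of its segment is straddled by a short arc of the aisle. If neither end
     is, the arc joining [x p - 1] and [x q - 1] starts strictly below both ends and crosses. *)
  have [kp|kp] := ltP (k + 1) (x p).
    exists (p, k), (p, k + 2); split.
      by rewrite /std_aisle (same_block_refl _ nP) varcE /=; lia.
    by rewrite vcross_btw /vbtw /vsh/= !vltE !xpair_eqE -!val_eqE/=; clear -npq'; vlia.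
  have [kq|kq] := ltP (k + 1) (x q).
    exists (q, k), (q, k + 2); split.
      by rewrite /std_aisle (same_block_refl _ nP) varcE /=; lia.
    by rewrite vcross_btw /vbtw /vsh/= !vltE !xpair_eqE -!val_eqE/=; clear -npq'; vlia.
  exists (p, x p - 1), (q, x q - 1); split.
    by rewrite /std_aisle pq varcE npq' /=; lia.
  rewrite vcross_btw /vbtw /vsh/= !vltE !xpair_eqE -!val_eqE/=.
  by move: (x p) (x q) kp kq => i j kp kq; clear -npq' kp kq; vlia.
(* This lifts both ends to at least the heights; the extra shift by one in [t2] puts them strictly
   above. *)
pose k := Num.max (x u.1 - u.2) (x v.1 - v.2).
exists k; apply/t2; first by rewrite varc_vsh.
move=> [[r i] [[s j] [/and4P[/= _ /sing <- ir js]]]].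
apply/negP; apply: same_segment_uncrossed ir js _ _; rewrite /= /k; lia.
Qed.

End Classes.

(** * The greatest and the least class *)

Section Extremes.
Variables (K : fieldType) (C : triangulated_category K) (n : nat).
Variables (e : 'I_n * int -> 'I_n * int -> C) (hM : arc_model e).

Lemma bounded_above_top : is_top_in (nondegenerate_classes C) tclass_le
  [set t | [/\ is_tstructure t, nondegenerate_tpair t & bounded_above t]].
Proof.
have [||P nP sbP] := @noncrossing_rel n (fun _ _ => true) => //.
have -> : [set t | [/\ is_tstructure t, nondegenerate_tpair t & bounded_above t]] =
    partition_class e P.
  apply/seteqP; split=> t [ts]; last first.
    move=> [x tx]; split=> //; first exact: (std_form_nondegenerate hM nP ts tx).
    by apply/(bounded_aboveP hM nP ts tx) => p q; rewrite sbP.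
  move=> nd ba; split=> //.
  have [P' [x [nP' tx]]] := nondegenerate_std_form hM ts nd; exists x.
  suff -> : P = P' by [].
  apply: refines_anti => //; apply/refinesP => // p q _; last by rewrite sbP.
  by move/(bounded_aboveP hM nP' ts tx): ba; apply.
split; first by apply/(nondegenerate_classesP hM); exists P.
move=> _ /(nondegenerate_classesP hM)[P' nP' ->].
by apply/(partition_class_le hM) => //; apply/refinesP => // p q _; rewrite sbP.
Qed.

Lemma bounded_below_bottom : is_bottom_in (nondegenerate_classes C) tclass_le
  [set t | [/\ is_tstructure t, nondegenerate_tpair t & bounded_below t]].
Proof.
have [||P nP sbP] := @noncrossing_rel n (fun p q => p == q).
- by move=> p q r; split=> // /eqP ->.
- by move=> i k j l ik kj jl /eqP ij _; move: (ltn_trans ik kj); rewrite ij ltnn.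
have -> : [set t | [/\ is_tstructure t, nondegenerate_tpair t & bounded_below t]] =
    partition_class e P.
  apply/seteqP; split=> t [ts]; last first.
    move=> [x tx]; split=> //; first exact: (std_form_nondegenerate hM nP ts tx).
    by apply/(bounded_belowP hM nP ts tx) => p q; rewrite sbP => /eqP.
  move=> nd ba; split=> //.
  have [P' [x [nP' tx]]] := nondegenerate_std_form hM ts nd; exists x.
  suff -> : P = P' by [].
  apply: refines_anti => //; apply/refinesP => // p q; rewrite sbP.
    by move=> /eqP ->; exact: same_block_refl.
  by move/(bounded_belowP hM nP' ts tx): ba => h /h ->.
split; first by apply/(nondegenerate_classesP hM); exists P.
move=> _ /(nondegenerate_classesP hM)[P' nP' ->].
apply/(partition_class_le hM) => //; apply/refinesP => // p q; rewrite sbP => /eqP ->.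
exact: same_block_refl.
Qed.

End Extremes.

Theorem corollary5p7 (R : realType) (K : fieldType) (n : nat) (hn : (2 <= n)%N)
    (Z : set (R * R)) (hZ : admissible n Z)
    (C : triangulated_category K) (E : set (R * R) -> C)
    (hC : discrete_cluster_category Z E) :
  [/\ lattice_isomorphic
        (nondegenerate_classes C) tclass_le
        [set P : {set {set 'I_n}} | noncrossing_partition P] (@refines n),
      is_top_in (nondegenerate_classes C) tclass_le
        [set t | [/\ is_tstructure t, nondegenerate_tpair t & bounded_above t]]
    & is_bottom_in (nondegenerate_classes C) tclass_le
        [set t | [/\ is_tstructure t, nondegenerate_tpair t & bounded_below t]]].
Proof.
have [phi [phi_inj phiZ phi_surj phi_cyc]] := circle_model (ltnW hn) hZ.
have hM := discrete_cluster_arc_model phi_inj phiZ phi_surj phi_cyc hC.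
by split; [exact: classes_isomorphic hM|exact: bounded_above_top hM
  |exact: bounded_below_bottom hM].
Qed.
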